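(* Let $T$ be a sublinear operator, mapping characteristic functions of finite measure sets to measurable functions, and assume that $T$ obeys $$\int_F |T\chi_E(\boldsymbol x)|\, d\boldsymbol x \leq C_j |E|^{1/p_j}|F|^{1/q_j'}, \qquad j=0,1,$$ for all bounded, measurable $E,F \subseteq \mathbb R^n$ and some $1 \leq p_j,q_j \leq \infty$, with $p_0 \neq p_1$ and $q_0 \neq q_1$. For $0 \leq \theta \leq 1$, define $(p_\theta,q_\theta)$ in the usual way, by $$\frac1{p_\theta} := \frac{1-\theta}{p_0}+\frac\theta{p_1}, \qquad \frac1{q_\theta}:= \frac{1-\theta}{q_0}+\frac\theta{q_1}.$$ Given a measurable $f$ with binary decomposition $$f = \sum_j 2^j \chi_{F_j^1} - \sum_j 2^j\chi_{F_j^2} + i\Big[\sum_j 2^j \chi_{F_j^3} - \sum_j 2^j \chi_{F_j^4}\Big],$$ for $1 \leq u < v \leq \infty$ and $0 < \theta < 1$, $$\|Tf\|_{L^{q_\theta,v}} \lesssim \sup_{j,k} \|2^jT\chi_{F_j^k}\|_{L^{q_\theta,v}}^{1-\nu}\,\|f\|_{L^{p_\theta,u}}^\nu.$$ Here $\nu$ depends on $\frac1u-\frac1v$, and the implicit constant depends on $C_0,C_1,\theta,u,v$, and $p_0,p_1,q_0,q_1$.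
   Context: Binary decomposition: let $f$ be an arbitrary, complex-valued, measurable function. After decomposing $f$ into its real and imaginary parts and then each of those into their positive and negative components, one expands the values in binary. This gives the displayed expansion of $f$, with $j$ ranging over $\mathbb Z$, $k\in\{1,2,3,4\}$, and measurable sets $F_j^k$ depending on $f$: the sets $F_j^1,F_j^2$ come from the positive and negative components of the real part, and $F_j^3,F_j^4$ from those of the imaginary part. The expansion is regarded as uniquely determined by $f$. $\|\cdot\|_{L^{p,u}}$ denotes the usual Lorentz quasi-norm (or, for $p>1$, an equivalent norm); for $u<\infty$, $\|f\|_{L^{p,u}}$ is comparable to $\big(\sum_{j,k}2^{ju}|F_j^k|^{u/p}\big)^{1/u}$. Primes denote dual exponents ($\frac1q+\frac1{q'}=1$), $|E|$ is the Lebesgue measure of $E$, and $\chi_E$ is its characteristic function. $X\lesssim Y$ means $|X|\le CY$ for a positive constant $C$ (the implicit constant).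
   Formalization: T is also assumed subadditive (a.e.) along countable series dominated by a function in its domain; with finite sublinearity only, a linear T vanishing on simple functions but not at f obeys the bounds with C_j = 0 and violates the claim. *)

(* Defs.v *)
From HB Require Import structures.
From mathcomp Require Import all_boot all_order all_algebra.
From mathcomp Require Import all_classical all_reals all_analysis.
From mathcomp Require Import complex.

Set Implicit Arguments.
Unset Strict Implicit.
Unset Printing Implicit Defensive.
Import Order.TTheory GRing.Theory Num.Theory.
Import numFieldNormedType.Exports.

Local Open Scope classical_set_scope.
Local Open Scope ring_scope.

(** * Lebesgue measure on R^n *)

Section lebesgue.
Variable R : realType.

(* The n-fold product of the Lebesgue measure of R, on the Borel sets of
   n.-tuple R. *)
Fixpoint borel_lebesgue (n : nat) : set (n.-tuple R) -> \bar R :=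
  match n with
  | 0 => fun A => \d_[tuple] A
  | n.+1 => fun A => (\int[@lebesgue_measure R]_x
                        borel_lebesgue [set t : n.-tuple R | A (cons_tuple x t)])%E
  end.

Lemma borel_lebesgue_sigma_finite_measure (n : nat) :
  exists m : {sigma_finite_measure set (n.-tuple R) -> \bar R},
    forall A, borel_lebesgue A = m A.
Proof.
elim: n => [|n [m mE]]; first by exists (\d_[tuple] : {sigma_finite_measure set _ -> \bar R}).
pose consp (z : R * n.-tuple R) : n.+1.-tuple R := cons_tuple z.1 z.2.
have measurable_consp : measurable_fun [set: R * n.-tuple R] consp.
  exact: measurable_cons measurable_fst measurable_snd.
pose P := pushforward (@lebesgue_measure R \x m)%E consp.
have PE A : borel_lebesgue A = P A.
  rewrite /P /pushforward /product_measure1 /=; apply: eq_integral => x _.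
  by rewrite mE /=; congr (m _); apply/seteqP; split=> t; rewrite /xsection/= inE.
have beheadK (x : R) (t : n.-tuple R) : behead_tuple (cons_tuple x t) = t.
  exact: val_inj.
have P0 : P set0 = 0%E by rewrite /P /pushforward preimage_set0 measure0.
have Pge0 A : (0 <= P A)%E by rewrite /P /pushforward measure_ge0.
have Padd : semi_sigma_additive P.
  move=> F mF tF mUF; rewrite /P /pushforward preimage_bigcup.
  apply: measure_semi_sigma_additive => //.
  - by move=> k; rewrite -[X in measurable X]setTI; exact: measurable_consp.
  - apply/trivIsetP => /= i j _ _ ij; rewrite -preimage_setI.
    by move/trivIsetP : tF => /(_ _ _ _ _ ij) ->//; rewrite preimage_set0.
  - by rewrite -preimage_bigcup -[X in measurable X]setTI; exact: measurable_consp.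
have Psf : sigma_finite [set: n.+1.-tuple R] P.
  have /sigma_finiteP[F [TF ndF Foo]] := sigma_finiteT (@lebesgue_measure R).
  have /sigma_finiteP[G [TG ndG Goo]] := sigma_finiteT m.
  have mh : measurable_fun setT (fun t : n.+1.-tuple R => thead t).
    exact: measurable_tnth.
  have mb : measurable_fun setT (fun t : n.+1.-tuple R => behead_tuple t).
    exact: measurable_behead.
  exists (fun k => [set t : n.+1.-tuple R | F k (thead t) /\ G k (behead_tuple t)]).
    apply/seteqP; split=> // t _.
    have [i _ Fi] : (\bigcup_i F i) (thead t) by rewrite -TF.
    have [j _ Gj] : (\bigcup_i G i) (behead_tuple t) by rewrite -TG.
    exists (maxn i j) => //; split.
      by move: Fi; exact/subsetPset/ndF/leq_maxl.
    by move: Gj; exact/subsetPset/ndG/leq_maxr.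
  move=> k; have [mF Fk] := Foo k; have [mG Gk] := Goo k; split.
    rewrite (_ : [set _ | _] = (@thead n R @^-1` F k) `&` (@behead_tuple n.+1 R @^-1` G k))//.
    apply: measurableI.
      by rewrite -[X in measurable X]setTI; exact: mh.
    by rewrite -[X in measurable X]setTI; exact: mb.
  rewrite /P /pushforward.
  rewrite (_ : _ @^-1` _ = F k `*` G k); last first.
    by apply/seteqP; split=> -[x t] /=; rewrite /consp theadE beheadK.
  by rewrite product_measure1E// lte_mul_pinfty// ge0_fin_numE.
clearbody P.
pose mP := isMeasure.Build _ _ _ P P0 Pge0 Padd.
pose M : {measure set (n.+1.-tuple R) -> \bar R} := HB.pack P mP.
pose sP := @Measure_isSigmaFinite.Build _ _ _ M Psf.
pose S : {sigma_finite_measure set (n.+1.-tuple R) -> \bar R} := HB.pack (M : set _ -> _) mP sP.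
by exists S.
Qed.

End lebesgue.

Section measure_instance.
Variables (R : realType) (n : nat).
Local Notation mu := (@borel_lebesgue R n).

Let mu0 : mu set0 = 0%E.
Proof.
by have [m mE] := borel_lebesgue_sigma_finite_measure R n; rewrite mE measure0.
Qed.

Let mu_ge0 A : (0 <= mu A)%E.
Proof.
by have [m mE] := borel_lebesgue_sigma_finite_measure R n; rewrite mE measure_ge0.
Qed.

Let mu_semi_sigma_additive : semi_sigma_additive mu.
Proof.
have [m mE] := borel_lebesgue_sigma_finite_measure R n.
by rewrite (_ : mu = m); [exact: measure_semi_sigma_additive|exact/funext].
Qed.

HB.instance Definition _ := isMeasure.Build _ _ _ mu
  mu0 mu_ge0 mu_semi_sigma_additive.

Let mu_sigma_finite : sigma_finite setT mu.
Proof.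
have [m mE] := borel_lebesgue_sigma_finite_measure R n.
by rewrite (_ : mu = m); [exact: sigma_finiteT|exact/funext].
Qed.

HB.instance Definition _ := @Measure_isSigmaFinite.Build _ _ _ mu mu_sigma_finite.

End measure_instance.

Section euclidean.
Variable R : realType.

(* R^n with its Lebesgue (not merely Borel) measurable sets. *)
Definition Rn (n : nat) : measurableType _ :=
  caratheodory_type (@borel_lebesgue R n)^*%mu.

Definition vol (n : nat) : {measure set (Rn n) -> \bar R} :=
  @completed_measure_extension _ _ _ (@borel_lebesgue R n).

Definition bounded_subset (n : nat) (A : set (Rn n)) : Prop :=
  exists M : R, forall x : n.-tuple R, A x -> forall i, `|tnth x i| <= M.

End euclidean.
Arguments Rn : clear implicits.
Arguments vol : clear implicits.

Section notions.
Variables (R : realType) (n : nat).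
Local Notation C := (R[i]).
Local Notation cabs := (@ComplexField.Normc.normc R).
Implicit Types (f g h : Rn R n -> C) (E : set (Rn R n)) (p u : \bar R).

Definition cmeasurable f : Prop :=
  measurable_fun setT (fun x => complex.Re (f x)) /\
  measurable_fun setT (fun x => complex.Im (f x)).

Definition chi E : Rn R n -> C := fun x => (\1_E x)%:C%C.

(** * Lorentz quasi-norms *)

Definition distribution_function f (s : R) : \bar R :=
  vol R n [set x | s < cabs (f x)].

(* p^(1/u) || s d_f(s)^(1/p) ||_(L^u(ds/s)), which is equal to
   || t^(1/p) f^*(t) ||_(L^u(dt/t)) where f^* is the decreasing rearrangement
   of f. The value at u = -oo is irrelevant. *)
Definition lorentz (p : R) u f : \bar R :=
  (let w s := s%:E * distribution_function f s `^ (p^-1)%R in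
  match u with
  | r%:E => (p%:E * \int[@lebesgue_measure R]_(s in `]0%R, +oo[)
                (w s `^ r * (s^-1)%R%:E)) `^ (r^-1)%R
  | +oo => ereal_sup [set w s | s in `]0%R, +oo[]
  | -oo => 0
  end)%E.

(** * Binary decomposition *)

Definition component (k : 'I_4) f : Rn R n -> R :=
  match val k with
  | 0 => (fun x => complex.Re (f x))^\+
  | 1 => (fun x => complex.Re (f x))^\-
  | 2 => (fun x => complex.Im (f x))^\+
  | _ => (fun x => complex.Im (f x))^\-
  end.

(* The set F_j^(k+1) of the points at which the binary digit of weight 2^j of
   the k-th component of f is 1; a dyadic rational is given its finite
   expansion. *)
Definition binary_set f (j : int) (k : 'I_4) : set (Rn R n) :=
  [set x | odd `|Num.floor (component k f x / 2 ^ j)|%N].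

(** * Sublinear operators *)

(* T is defined on a linear space D of measurable functions containing the
   characteristic functions of sets of finite measure. Finite subadditivity
   alone says nothing about the action of T on the (infinite) binary
   decomposition of f, nor about T (chi E) for E of finite measure but not
   bounded; the last clause is the subadditivity of T along series that are
   dominated in D. *)
Record sublinear (D : set (Rn R n -> C)) (T : (Rn R n -> C) -> (Rn R n -> C)) :
    Prop := Sublinear {
  sublinear_domain : D `<=` cmeasurable ;
  sublinear_chi : forall E, measurable E -> (vol R n E < +oo)%E -> D (chi E) ;
  sublinear_addr_closed : forall f g, D f -> D g -> D (f \+ g) ;
  sublinear_scale_closed : forall (c : C) f, D f -> D (fun x => c * f x) ;
  sublinear_measurable : forall f, D f -> cmeasurable (T f) ;
  sublinear_scale : forall (c : C) f, D f ->
    {ae vol R n, forall x, cabs (T (fun y => c * f y) x) = cabs c * cabs (T f x)} ;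
  sublinear_add : forall f g, D f -> D g ->
    {ae vol R n, forall x, cabs (T (f \+ g) x) <= cabs (T f x) + cabs (T g x)} ;
  sublinear_series : forall f h (g : nat -> Rn R n -> C),
    D f -> D h -> (forall m, D (g m)) ->
    {ae vol R n, forall x,
      cabs (f x - \sum_(0 <= m < N) g m x) @[N --> \oo] --> 0} ->
    {ae vol R n, forall x,
      (\sum_(0 <= m <oo) (cabs (g m x))%:E <= (cabs (h x))%:E)%E} ->
    {ae vol R n, forall x,
      ((cabs (T f x))%:E <= \sum_(0 <= m <oo) (cabs (T (g m) x))%:E)%E} }.

(* 1/p, with 1/oo = 0 *)
Definition rinv p : R := fine (p^-1)%E.

(* 1/q' is written 1 - 1/q. *)
Definition restricted_type (T : (Rn R n -> C) -> (Rn R n -> C)) p (q : \bar R)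
    (K : R) : Prop :=
  forall E F : set (Rn R n),
    measurable E -> bounded_subset E -> measurable F -> bounded_subset F ->
    (\int[vol R n]_(x in F) (cabs (T (chi E) x))%:E
      <= K%:E * vol R n E `^ rinv p * vol R n F `^ (1 - rinv q)%R)%E.

End notions.

(* Main.v *)
Require Import Defs.
From HB Require Import structures.
From mathcomp Require Import all_boot all_order all_algebra.
From mathcomp Require Import all_classical all_reals all_analysis.
From mathcomp Require Import measurable_realfun complex.
From mathcomp Require Import ring lra.
Import Order.TTheory GRing.Theory Num.Theory.
Import numFieldNormedType.Exports.
Local Open Scope classical_set_scope.
Local Open Scope ring_scope.

Set Implicit Arguments.
Unset Strict Implicit.
Unset Printing Implicit Defensive.

(** Write a_i = 1/p_i, b_i = 1/q_i, a = 1/p_theta, b = 1/q_theta, d_g for the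
    distribution function of g, and A for the supremum on the right-hand side.

    Let F be a bounded set of measure t inside the level set where |T f| > s.
    Subadditivity along the binary series of f gives
      s t <= sum over j, k of 2^j times the integral over F of |T chi_(F_j^k)|,
    and each summand has three bounds: one from each restricted type hypothesis
    and A t^(1-b) from Hölder's inequality for weak L^(q_theta), all up to
    constants. The piece F_j^k lies where |f| > 2^(j-1), hence has measure at
    most x_j = d_f(2^(j-1)), and dividing by t yields
      s <= C sum_j min(2^j x_j^a0 t^-b0, 2^j x_j^a1 t^-b1, A t^-b).
    The right-hand side decreases with t, so when d_(T f)(s) >= 2^M it is
    enough that t > 2^(M-1), which some bounded F achieves; this is
    distribution_le_piece_bound.

    The rest concerns sequences (interpolation_sum, interpolation_sup). Group
    the j with x_j between 2^N and 2^(N+1). With alpha = a0 - a1 and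
    beta = b0 - b1, the first two bounds are together at most
      2^j 2^(N a) 2^(-M b) 2^(-c |alpha N - beta M|),
    and the minimum with the third is at most their nu-th power times the
    (1 - nu)-th power of A 2^(-M b) (piece_bound_le). In each group the sum
    over j is geometric, so it is governed by its largest term z_N, and the
    L^(p_theta, u) norm of f controls the l^u norm of z (level_profile). Thus
      2^(M b) s <= C A^(1-nu) sum_N z_N^nu 2^(-c nu |alpha N - beta M|).
    As alpha and beta are nonzero this kernel is bounded on l^v (schur_exp2),
    and z^nu is in l^v as soon as nu v >= u: the room between u and v pays for
    the factor A^(1-nu). With d = 1/u - 1/v one has u/v <= 1 - d, and
    nu = 1 - d/2 lies strictly between 0 and 1 even when u = 1 and v = +oo.

    Two points are not covered by this sketch. The restricted type hypotheses
    speak of bounded sets, whereas the F_j^k are unbounded sets of finite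
    measure; the same bounds hold for these, by cutting them along an
    exhaustion of R^n (restricted_type_unbounded). And when A or the norm of f
    vanishes, the product on the right-hand side is 0 even if the other factor
    is infinite; then T chi_(F_j^k) vanishes almost everywhere for all j and k,
    and so does T f. *)

(** * Powers of two and sums over the integers *)

Section convex_combination.
Variable R : realType.

Lemma convex_comb_gt0 (th r0 r1 : R) : 0 < th < 1 ->
  0 <= r0 -> 0 <= r1 -> r0 != r1 ->
  0 < (1 - th) * r0 + th * r1.
Proof.
move=> /andP[t0 t1] r00 r10 r01.
have [r0e|r0n] := eqVneq r0 0.
  by rewrite r0e mulr0 add0r mulr_gt0// lt_def r10 -r0e eq_sym r01.
by rewrite ltr_pwDl ?mulr_ge0 ?(ltW t0)// mulr_gt0 ?subr_gt0// lt_def r0n.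
Qed.

Lemma convex_comb_lt1 (th r0 r1 : R) : 0 < th < 1 -> r0 <= 1 -> r1 <= 1 -> r0 != r1 ->
  (1 - th) * r0 + th * r1 < 1.
Proof.
move=> th01 r01 r11 r0r1.
have : 0 < (1 - th) * (1 - r0) + th * (1 - r1).
  apply: convex_comb_gt0 => //; rewrite ?subr_ge0//.
  by apply: contra_neq r0r1 => /(addrI 1)/oppr_inj.
lra.
Qed.

End convex_combination.

Section exp2.
Variable R : realType.
Implicit Types x y r : R.

Lemma exp2_gt0 x : 0 < 2 `^ x.
Proof. by rewrite powR_gt0. Qed.

Lemma exp2D x y : 2 `^ (x + y) = 2 `^ x * 2 `^ y.
Proof. by rewrite powRD// pnatr_eq0 implybT. Qed.

Lemma ler_exp2 x y : (2 `^ x <= 2 `^ y) = (x <= y).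
Proof.
rewrite /powR pnatr_eq0/= ler_expR ler_pM2r//.
by rewrite ln_gt0// ltr1n.
Qed.

Lemma ltr_exp2 x y : (2 `^ x < 2 `^ y) = (x < y).
Proof. by rewrite !ltNge ler_exp2. Qed.

Lemma exp2_log x : 0 < x -> 2 `^ (ln x / ln 2) = x.
Proof.
move=> x0; rewrite /powR pnatr_eq0/= divfK ?lnK ?posrE//.
by rewrite gt_eqF// ln_gt0// ltr1n.
Qed.

Lemma exp2_itv x : 0 < x ->
  exists N : int, 2 `^ N%:~R <= x < 2 `^ (N%:~R + 1).
Proof.
move=> x0; exists (Num.floor (ln x / ln 2)).
rewrite -{2 3}(exp2_log x0) ler_exp2 ltr_exp2.
by have := floor_itv (ln x / ln 2); rewrite rmorphD.
Qed.

Lemma exp2_unbounded r : 0 < r -> forall t, exists N : int, t <= 2 `^ (N%:~R * r).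
Proof.
move=> r0 t; have [t0|t0] := leP t 0; first by exists 0; rewrite (le_trans t0)// powR_ge0.
have [N /andP[_ Nt]] := exp2_itv (powR_gt0 r^-1 t0).
exists (N + 1); rewrite powRrM intrD.
rewrite [leLHS](_ : t = (t `^ r^-1) `^ r); last first.
  by rewrite -powRrM mulVf ?gt_eqF// powRr1// ltW.
by rewrite ge0_ler_powR ?nnegrE ?powR_ge0 ?ltW.
Qed.

End exp2.

Section series.
Variable R : realType.
Local Open Scope ereal_scope.

Lemma esum_term_le (T : choiceType) (a : T -> \bar R) t :
  (forall i, 0 <= a i) -> a t <= \esum_(i in [set: T]) a i.
Proof.
move=> a0; apply: esum_ge; exists [set t]; last by rewrite fsbig_set1.
by split=> //; exact: finite_set1.
Qed.

Lemma esum_exchange (S T : choiceType) (a : S -> T -> \bar R) :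
  (forall i j, 0 <= a i j) ->
  \esum_(i in [set: S]) \esum_(j in [set: T]) a i j =
  \esum_(j in [set: T]) \esum_(i in [set: S]) a i j.
Proof.
move=> a0; rewrite !esum_esum//.
rewrite (@reindex_esum R _ _ ([set: T] `*`` fun=> [set: S]) ([set: S] `*`` fun=> [set: T])
  (fun z => (z.2, z.1)))//=.
split=> //=.
- by move=> [i j] [i' j'] _ _ /= [-> ->].
- by move=> [i j] _ /=; exists (j, i).
Qed.

Lemma esumZl (T : choiceType) (c : R) (a : T -> \bar R) : (0 <= c)%R ->
  (forall i, 0 <= a i) ->
  \esum_(i in [set: T]) (c%:E * a i) = c%:E * \esum_(i in [set: T]) a i.
Proof.
have le (e : R) (b : T -> \bar R) : (0 <= e)%R -> (forall i, 0 <= b i) ->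
    \esum_(i in [set: T]) (e%:E * b i) <= e%:E * \esum_(i in [set: T]) b i.
  move=> e0 b0; apply: ge_ereal_sup => _ [X [finX _]] <-.
  rewrite -ge0_mule_fsumr//; apply: lee_wpmul2l; first by rewrite lee_fin.
  by apply: esum_ge; exists X.
move=> c0 a0; apply/eqP; rewrite eq_le le//=.
have [->|cn0] := eqVneq c 0%R.
  by rewrite mul0e esum_ge0// => i _; rewrite mul0e.
have cp : (0 < c)%R by rewrite lt_def cn0.
rewrite -lee_pdivlMl// (le_trans _ (le _ _ _ _))//.
- by apply: le_esum => i _; rewrite muleA -EFinM mulVf// mul1e.
- by rewrite invr_ge0.
- by move=> i; rewrite mule_ge0// lee_fin.
Qed.

Lemma esum_int_shift (n : int) (a : int -> \bar R) :
  \esum_(i in [set: int]) a i = \esum_(i in [set: int]) a (i + n)%R.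
Proof.
apply: reindex_esum; split=> //=.
- by move=> i j _ _ /addIr.
- by move=> j _; exists (j - n)%R => //; rewrite subrK.
Qed.

(** Pairs m with - m - 1: the form in which sums over the integers are
    integrated term by term. *)
Lemma esum_int (a : int -> \bar R) : (forall i, 0 <= a i) ->
  \esum_(i in [set: int]) a i = \sum_(0 <= m <oo) (a (Posz m) + a (Negz m)).
Proof.
move=> a0; rewrite nneseriesD//.
rewrite (esumID (range Posz))// !setTI; congr (_ + _).
  by rewrite esum_image ?nneseries_esumT//; move=> i j _ _ [].
have -> : ~` range Posz = range Negz.
  apply/seteqP; split=> [[m|m]|_ [m _ <-] [k _]]//= h; last by exists m.
  by exfalso; apply: h; exists m.
by rewrite esum_image ?nneseries_esumT//; move=> i j _ _ [].
Qed.

Lemma geometric_nneseries_le (rho : R) : (0 <= rho < 1)%R ->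
  \sum_(0 <= m <oo) (rho ^+ m)%:E <= ((1 - rho)^-1)%:E.
Proof.
move=> /andP[r0 r1]; apply: lime_le.
  by apply: is_cvg_nneseries => n _ _; rewrite lee_fin exprn_ge0.
apply: nearW => n; rewrite sumEFin lee_fin -[leRHS]mul1r ler_pdivlMr ?subr_gt0//.
have -> : ((\sum_(0 <= i < n) rho ^+ i) * (1 - rho) = 1 - rho ^+ n)%R.
  by rewrite mulrC -opprB mulNr big_mkord -subrX1 opprB.
by rewrite gerBl exprn_ge0.
Qed.

(** Translating by the floor of g costs a factor 2^c and leaves two geometric
    series. What matters is that C does not depend on the centre g: every
    summation over the integers below reduces to this one. *)
Lemma peak_sum_le (c : R) : (0 < c)%R -> exists2 C : R, (0 < C)%R &
  forall g : R, \esum_(i in [set: int]) (2 `^ (- c * `|i%:~R - g|))%:E <= C%:E.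
Proof.
move=> c0; pose rho : R := (2 `^ (- c))%R.
have rho0 : (0 < rho)%R by rewrite powR_gt0.
have rho1 : (rho < 1)%R.
  by rewrite /rho -[ltRHS](powRr0 2) ltr_exp2 oppr_lt0.
pose K : R := (2 `^ c * (2 * (1 - rho)^-1))%R.
have K0 : (0 < K)%R by rewrite !mulr_gt0 ?powR_gt0 ?invr_gt0 ?subr_gt0.
exists K => // g.
rewrite (esum_int_shift (Num.floor g)).
have h i : (2 `^ (- c * `|(i + Num.floor g)%:~R - g|) <= 2 `^ c * rho ^+ `|i|)%R.
  have -> : (rho ^+ `|i| = 2 `^ (- c * `|i%:~R|))%R.
    by rewrite powRrM -/rho -intr_norm -abszE -pmulrn powR_mulrn// ltW.
  rewrite -exp2D ler_exp2 !mulNr.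
  have /andP[g1 g2] := floor_itv g.
  have : (`|i%:~R| <= `|(i + Num.floor g)%:~R - g| + 1)%R.
    move: g1 g2; rewrite !rmorphD/=; set fg := (Num.floor g)%:~R.
    move: (i%:~R : R) => x g1 g2.
    have := ler_normD (x + fg - g)%R (g - fg)%R.
    rewrite (_ : (_ + _ + (g - fg) = x)%R); last by ring.
    by rewrite [X in (_ <= _ + X)%R]ger0_norm; lra.
  rewrite -(ler_pM2l c0) => h; lra.
apply: (@le_trans _ _ (\esum_(i in [set: int]) (2 `^ c * rho ^+ `|i|)%:E)).
  by apply: le_esum => i _; rewrite lee_fin h.
under eq_esum do rewrite EFinM.
rewrite esumZl ?powR_ge0//; last by move=> i; rewrite lee_fin exprn_ge0// ltW.
rewrite EFinM lee_pmul2l ?fin_numE ?lte_fin ?powR_gt0//.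
rewrite esum_int => [|i]; last by rewrite lee_fin exprn_ge0// ltW.
rewrite mulr_natl mulr2n EFinD nneseriesD; first last.
- by move=> i _ _; rewrite lee_fin exprn_ge0// ltW.
- by move=> i _ _; rewrite lee_fin exprn_ge0// ltW.
have le1 : \sum_(0 <= m <oo) (rho ^+ m)%:E <= ((1 - rho)^-1)%:E.
  by apply: geometric_nneseries_le; rewrite rho1 ltW.
apply: leeD => //; apply: le_trans le1; apply: lee_nneseries => m _ /= => [_|].
  by rewrite lee_fin exprn_ge0// ltW.
by rewrite lee_fin exprS ler_piMl ?exprn_ge0 ?ltW.
Qed.

(** A geometric sum is governed by its largest term: below the cut b, the
    summand is at most b^r times a peak centred at the binary logarithm of b. *)
Lemma exp2_cut_sum_le (r : R) : (0 < r)%R -> exists2 C : R, (0 < C)%R &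
  forall (S : pred int) (b : R), (0 <= b)%R ->
    (forall j, S j -> 2 `^ j%:~R <= b)%R ->
    \esum_(j in [set: int]) (if S j then 2 `^ (j%:~R * r) else 0)%:E
      <= (C * b `^ r)%:E.
Proof.
move=> r0; have [C C0 hC] := peak_sum_le r0; exists C => // S b b0 Sb.
move: b0; rewrite le_eqVlt => /predU1P[b0|b0].
  rewrite esum1 ?lee_fin ?mulr_ge0 ?powR_ge0 ?(ltW C0)// => j _.
  by case: ifPn => // /Sb; rewrite -b0 leNgt exp2_gt0.
rewrite -(exp2_log b0); set g := (_ / _)%R; rewrite -powRrM mulrC EFinM.
apply: le_trans (lee_wpmul2l _ (hC g)); last by rewrite lee_fin powR_ge0.
rewrite -esumZl ?powR_ge0//; apply: le_esum => j _; rewrite lee_fin -exp2D.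
case: ifPn => [/Sb|_]; last exact: powR_ge0.
rewrite -(exp2_log b0) -/g !ler_exp2 => jg.
by rewrite distrC ger0_norm ?subr_ge0//; lra.
Qed.

(** The term N with 2^N <= x < 2^(N+1) is enough; for x = +oo the sum
    diverges. *)
Lemma poweR_le_exp2_sum (r : R) : (0 < r)%R -> forall x : \bar R, 0 <= x ->
  x `^ r <= (2 `^ r)%:E *
    \esum_(N in [set: int]) (if ((2 `^ N%:~R)%:E <= x)%E then 2 `^ (N%:~R * r) else 0)%:E.
Proof.
pose a (x : \bar R) (N : int) : \bar R :=
  (if ((2 `^ N%:~R)%:E <= x)%E then 2 `^ (N%:~R * r) else 0)%:E.
have a0 x N : 0 <= a x N by rewrite /a lee_fin; case: ifP; rewrite ?powR_ge0.
move=> r0 x x0; rewrite -/(a x).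
have [->|xn0] := eqVneq x 0.
  rewrite poweR0r ?gt_eqF//.
  apply: mule_ge0; first by rewrite lee_fin powR_ge0.
  by apply: esum_ge0 => N _; exact: a0.
case: x x0 xn0 => [x x0 xn0|_ _|//].
  have {x0 xn0}x0 : (0 < x)%R by rewrite lt_def -lee_fin x0 andbT.
  have [N /andP[Nx xN]] := exp2_itv x0.
  apply: (@le_trans _ _ ((2 `^ r)%:E * a x%:E N)); last first.
    by apply: lee_wpmul2l; [rewrite lee_fin powR_ge0|exact: esum_term_le].
  rewrite /a !lee_fin Nx -exp2D.
  rewrite -{2}[r]mul1r -mulrDl [(1 + _)%R]addrC powRrM.
  by rewrite ge0_ler_powR ?nnegrE ?powR_ge0 ?ltW.
rewrite [X in _ * X](_ : _ = +oo) ?gt0_muley ?lte_fin ?exp2_gt0//.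
  by rewrite leey.
apply: eq_infty => t; have [N tN] := exp2_unbounded r0 t.
rewrite -lee_fin in tN; apply: le_trans tN _.
by apply: le_trans (esum_term_le N (a0 +oo)); rewrite /a leey.
Qed.

End series.

(** * The discrete interpolation inequality *)

Section discrete.
Variable R : realType.
Implicit Types (al be a b c r t A B u v nu : R).

Lemma affine_peak_sum_le al c : al != 0 -> 0 < c -> exists2 C : R, 0 < C &
  forall t, (\esum_(i in [set: int]) (2 `^ (- c * `|al * i%:~R - t|))%:E <= C%:E)%E.
Proof.
move=> al0 c0.
have [|C C0 hC] := @peak_sum_le R (c * `|al|); first by rewrite mulr_gt0 ?normr_gt0.
exists C => // t; apply: le_trans (hC (t / al)); apply: le_esum => i _.
rewrite lee_fin ler_exp2 -mulNr -mulrA -normrM mulrBr (mulrC t) mulrA.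
by rewrite mulfV// mul1r.
Qed.

(** Boundedness of the kernel on l^v, for every v > 0. Half of the decay makes
    the sum over N converge once each term of the row M has been bounded by the
    l^v norm V_M of that row; the other half makes the sum of V_M^v over M
    converge. *)
Lemma schur_exp2 al be c v : al != 0 -> be != 0 -> 0 < c -> 0 < v ->
  exists2 C : R, 0 < C & forall (y : int -> R) (Y : R), (forall N, 0 <= y N) ->
  (\esum_(N in [set: int]) (y N `^ v)%:E <= Y%:E)%E ->
  exists V : int -> R, [/\ forall M, 0 <= V M,
    forall M, (\esum_(N in [set: int])
       (y N * 2 `^ (- c * `|al * N%:~R - be * M%:~R|))%:E <= (C * V M)%:E)%E &
    (\esum_(M in [set: int]) (V M `^ v)%:E <= (C * Y)%:E)%E].
Proof.
move=> al0 be0 c0 v0.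
have c20 : 0 < c / 2 by rewrite divr_gt0.
have [C1 C10 hC1] := affine_peak_sum_le al0 c20.
have cv0 : 0 < c / 2 * v by rewrite mulr_gt0.
have [C2 C20 hC2] := affine_peak_sum_le be0 cv0.
exists (C1 + C2); first by rewrite addr_gt0.
move=> y Y y0 yY.
pose k N M : R := 2 `^ (- (c / 2) * `|al * N%:~R - be * M%:~R|).
have k0 N M : 0 <= k N M by exact: powR_ge0.
pose W M : \bar R := \esum_(N in [set: int]) ((y N * k N M) `^ v)%:E.
have W0 M : (0 <= W M)%E by apply: esum_ge0 => N _; rewrite lee_fin powR_ge0.
have k1 N M : k N M <= 1.
  by rewrite -[leRHS](powRr0 2) ler_exp2 mulNr oppr_le0 mulr_ge0// ltW.
have WY M : (W M <= Y%:E)%E.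
  apply: le_trans yY; apply: le_esum => N _; rewrite lee_fin.
  by rewrite ge0_ler_powR ?nnegrE ?mulr_ge0 ?(ltW v0)// ler_piMr.
have Wfin M : W M \is a fin_num by rewrite ge0_fin_numE// (le_lt_trans (WY M))// ltry.
pose V M := fine (W M) `^ v^-1.
have VW M : (V M `^ v)%:E = W M.
  rewrite /V -powRrM mulVf ?gt_eqF// powRr1 ?fine_ge0// fineK//.
exists V; split=> [M|M|]; first exact: powR_ge0.
- have le N : y N * k N M <= V M.
    have h : (y N * k N M) `^ v <= V M `^ v.
      rewrite -lee_fin VW.
      by apply: (@esum_term_le _ _ (fun N => ((y N * k N M) `^ v)%:E)) => i; rewrite lee_fin powR_ge0.
    rewrite leNgt; apply/negP => /(gt0_ltr_powR v0).
    rewrite !nnegrE mulr_ge0 ?powR_ge0// => /(_ isT isT).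
    by rewrite ltNge h.
  apply: (@le_trans _ _ ((V M)%:E * C1%:E)%E); last first.
    by rewrite -EFinM lee_fin mulrC ler_wpM2r ?powR_ge0// lerDl ltW.
  apply: le_trans (lee_wpmul2l _ (hC1 (be * M%:~R))); last by rewrite lee_fin powR_ge0.
  rewrite -esumZl ?powR_ge0//; apply: le_esum => N _; rewrite lee_fin.
  rewrite (_ : - c * _ = - (c / 2) * `|al * N%:~R - be * M%:~R| +
     - (c / 2) * `|al * N%:~R - be * M%:~R|); last by lra.
  by rewrite exp2D mulrA ler_wpM2r ?powR_ge0// le.
- under eq_esum do rewrite VW.
  rewrite /W esum_exchange; last by move=> *; rewrite lee_fin powR_ge0.
  apply: (@le_trans _ _ (C2%:E * \esum_(N in [set: int]) (y N `^ v)%:E)%E); last first.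
    have Y0 : 0 <= Y by rewrite -lee_fin (le_trans _ yY)// esum_ge0// => N _; rewrite lee_fin powR_ge0.
    apply: (@le_trans _ _ (C2%:E * Y%:E)%E).
      by rewrite lee_wpmul2l// lee_fin ltW.
    by rewrite -EFinM lee_fin ler_wpM2r// lerDr ltW.
  rewrite -esumZl ?(ltW C20)//; last by move=> *; rewrite lee_fin powR_ge0.
  apply: le_esum => N _.
  rewrite muleC; apply: le_trans (lee_wpmul2l _ (hC2 (al * N%:~R))); last by rewrite lee_fin powR_ge0.
  rewrite -esumZl ?powR_ge0//; apply: le_esum => M _; rewrite lee_fin.
  by rewrite powRM// /k -powRrM distrC mulrAC mulNr.
Qed.

(** The inclusion of l^1 in l^p: z_N <= S, hence z_N^p <= S^(p-1) z_N. *)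
Lemma esum_powR_le (z : int -> R) (p S : R) : 1 <= p -> 0 <= S ->
  (forall N, 0 <= z N) ->
  (\esum_(N in [set: int]) (z N)%:E <= S%:E)%E ->
  (\esum_(N in [set: int]) (z N `^ p)%:E <= (S `^ p)%:E)%E.
Proof.
move=> p1 S0 z0 zS.
have p0 : 0 < p by lra.
have zSN N : z N <= S.
  by rewrite -lee_fin (le_trans _ zS)//; apply: (@esum_term_le _ _ (EFin \o z)).
apply: (@le_trans _ _ ((S `^ (p - 1))%:E * \esum_(N in [set: int]) (z N)%:E)%E).
  rewrite -esumZl ?powR_ge0//; apply: le_esum => N _; rewrite lee_fin.
  rewrite -mulr_powRB1// mulrC ler_wpM2r//.
  by rewrite ge0_ler_powR ?nnegrE// subr_ge0.
rewrite -[in leRHS]mulr_powRB1// EFinM muleC.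
by rewrite lee_wpmul2r// lee_fin powR_ge0.
Qed.

(** The number z_N stands for 2^(N a) times the decreasing rearrangement at 2^N
    of a function whose distribution function at 2^j is x_j. It is defined by
    an l^u sum, because a supremum over j is dominated by such a sum and the
    sums over j and N can be exchanged. *)
Lemma level_profile a u : 0 < a -> 0 < u -> exists2 C : R, 0 < C &
  forall (x : int -> R) (B : R), (forall j, 0 <= x j) ->
  (\esum_(j in [set: int]) (2 `^ (j%:~R * u) * x j `^ (a * u))%:E <= B%:E)%E ->
  exists z : int -> R, [/\ forall N, 0 <= z N,
    forall j N, 2 `^ N%:~R <= x j -> 2 `^ j%:~R * 2 `^ (N%:~R * a) <= z N &
    (\esum_(N in [set: int]) (z N `^ u)%:E <= (C * B)%:E)%E].
Proof.
move=> a0 u0; have au0 : 0 < a * u by rewrite mulr_gt0.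
have [C C0 hC] := exp2_cut_sum_le au0.
exists C => // x B x0 xB.
pose w N j : R := if 2 `^ N%:~R <= x j then (2 `^ j%:~R * 2 `^ (N%:~R * a)) `^ u else 0.
have w0 N j : 0 <= w N j by rewrite /w; case: ifP; rewrite ?powR_ge0.
pose W N := (\esum_(j in [set: int]) (w N j)%:E)%E.
have W0 N : (0 <= W N)%E by apply: esum_ge0 => j _; rewrite lee_fin.
have WB : (\esum_(N in [set: int]) W N <= (C * B)%:E)%E.
  rewrite /W esum_exchange; last by move=> i j; rewrite lee_fin.
  rewrite EFinM; apply: le_trans (lee_wpmul2l _ xB); last by rewrite lee_fin ltW.
  rewrite -esumZl ?(ltW C0)//; last by move=> j; rewrite lee_fin mulr_ge0 ?powR_ge0.
  apply: le_esum => j _.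
  rewrite -EFinM mulrCA EFinM.
  have h := hC (fun N : int => 2 `^ N%:~R <= x j) _ (x0 j) (fun _ => id).
  have u2 : (0 <= (2 `^ (j%:~R * u))%:E :> \bar R)%E by rewrite lee_fin powR_ge0.
  apply: le_trans (lee_wpmul2l u2 h).
  rewrite -esumZl ?powR_ge0//; last by move=> N; rewrite lee_fin; case: ifP; rewrite ?powR_ge0.
  apply: le_esum => N _; rewrite lee_fin /w; case: ifP => _; last by rewrite mulr0.
  by rewrite powRM ?powR_ge0// -!powRrM mulrA.
have Wfin N : W N \is a fin_num.
  rewrite ge0_fin_numE// (le_lt_trans _ (ltry (C * B)))// (le_trans _ WB)//.
  exact: esum_term_le.
pose z N := fine (W N) `^ u^-1.
have zW N : (z N `^ u)%:E = W N.
  by rewrite /z -powRrM mulVf ?gt_eqF// powRr1 ?fine_ge0// fineK.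
exists z; split=> [N|j N Nj|]; first exact: powR_ge0.
- rewrite leNgt; apply/negP => /(gt0_ltr_powR u0).
  rewrite !nnegrE mulr_ge0 ?powR_ge0// => /(_ isT isT).
  apply/negP; rewrite -leNgt -lee_fin zW.
  apply: le_trans (@esum_term_le _ _ (fun j => (w N j)%:E) j _); last by move=> i; rewrite lee_fin.
  by rewrite /w Nj.
- by under eq_esum do rewrite zW.
Qed.

End discrete.

Section interpolation.
Variable R : realType.
Variables (a0 a1 b0 b1 th u nu : R).
Hypotheses (th01 : 0 < th < 1) (a0_01 : 0 <= a0 <= 1) (a1_01 : 0 <= a1 <= 1).
Hypotheses (b0_ge0 : 0 <= b0) (b1_ge0 : 0 <= b1).
Hypotheses (a01 : a0 != a1) (b01 : b0 != b1) (u_gt0 : 0 < u) (nu01 : 0 < nu < 1).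
Let a := (1 - th) * a0 + th * a1.
Let b := (1 - th) * b0 + th * b1.
Implicit Types (x : int -> R) (A B K : R) (y : int -> \bar R).

(** Up to constants, the three bounds for 2^j times the mean of |T chi_E| over
    a set of measure 2^M, when E has measure x_j. *)
Definition piece_bound x A (M j : int) : R :=
  Num.min (Num.min (2 `^ j%:~R * x j `^ a0 * 2 `^ (- (M%:~R * b0)))
                   (2 `^ j%:~R * x j `^ a1 * 2 `^ (- (M%:~R * b1))))
          (A * 2 `^ (- (M%:~R * b))).

Lemma piece_bound_ge0 x A M j : 0 <= A -> 0 <= piece_bound x A M j.
Proof. by move=> A0; rewrite !le_min !mulr_ge0 ?powR_ge0. Qed.

Let a_gt0 : 0 < a.
Proof. by case/andP: a0_01 a1_01 => ? _ /andP[? _]; exact: convex_comb_gt0. Qed.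

Let b_gt0 : 0 < b.
Proof. exact: convex_comb_gt0. Qed.

Let m0 : R := Num.min th (1 - th).
Let m0_gt0 : 0 < m0.
Proof. by rewrite lt_min subr_gt0; case/andP: th01 => -> ->. Qed.
Let c := nu * m0.
Let c_gt0 : 0 < c.
Proof. by rewrite mulr_gt0//; case/andP: nu01. Qed.
Let al := a0 - a1.
Let be := b0 - b1.
Let al_neq0 : al != 0. Proof. by rewrite subr_eq0. Qed.
Let be_neq0 : be != 0. Proof. by rewrite subr_eq0. Qed.
Let dist (N M : int) := `|al * N%:~R - be * M%:~R|.

(** A minimum of two nonnegative numbers is at most any geometric mean of them;
    the restricted type bounds are given the weight nu. At the exponents a
    and b these two bounds would coincide, up to 2^(theta w) and
    2^((theta - 1) w) with w = alpha N - beta M, whence the decay in |w|. *)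
Lemma piece_bound_le x A (M j N : int) : 0 <= A -> 2 `^ N%:~R <= x j < 2 `^ (N%:~R + 1) ->
  piece_bound x A M j <= 2 * A `^ (1 - nu) * 2 `^ (- (M%:~R * b)) *
     (2 `^ j%:~R * 2 `^ (N%:~R * a)) `^ nu * 2 `^ (- c * dist N M).
Proof.
move=> A0 /andP[Nx xN]; have t0 := piece_bound_ge0 x M j A0.
move: nu01 => /andP[nu0 nu1].
have x0 : 0 < x j by rewrite (lt_le_trans _ Nx)// exp2_gt0.
pose e := 1 + j%:~R + N%:~R * a - M%:~R * b - m0 * dist N M.
have h1 : piece_bound x A M j <= 2 `^ e.
  have term ai bi : 0 <= ai <= 1 ->
      2 `^ j%:~R * x j `^ ai * 2 `^ (- (M%:~R * bi)) <=
      2 `^ (1 + j%:~R + N%:~R * ai - M%:~R * bi).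
    move=> /andP[ai0 ai1]; rewrite !exp2D ler_wpM2r ?powR_ge0//.
    rewrite [leRHS]mulrAC [leRHS]mulrC ler_wpM2l ?powR_ge0// -exp2D.
    have /le_trans -> // : x j `^ ai <= 2 `^ ((N%:~R + 1) * ai).
      by rewrite powRrM ge0_ler_powR ?nnegrE ?powR_ge0// ltW.
    by rewrite ler_exp2 mulrDl mul1r; lra.
  rewrite /piece_bound ge_min; apply/orP; left; rewrite ge_min; apply/orP.
  (* the sign of w decides which of the two restricted type bounds is better *)
  have [w|w] := leP (al * N%:~R - be * M%:~R) 0.
    left; apply: le_trans (term _ _ a0_01) _; rewrite ler_exp2 /e /dist ler0_norm//.
    have mw : th * (al * N%:~R - be * M%:~R) <= m0 * (al * N%:~R - be * M%:~R).
      by rewrite ler_wnM2r// ge_min lexx.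
    move: mw; rewrite /a /b /al /be; lra.
  right; apply: le_trans (term _ _ a1_01) _; rewrite ler_exp2 /e /dist gtr0_norm//.
  have mw : m0 * (al * N%:~R - be * M%:~R) <= (1 - th) * (al * N%:~R - be * M%:~R).
    by rewrite ler_wpM2r ?(ltW w)// ge_min lexx orbT.
  move: mw; rewrite /a /b /al /be; lra.
have h2 : piece_bound x A M j <= A * 2 `^ (- (M%:~R * b)).
  by rewrite /piece_bound ge_min lexx orbT.
move: (piece_bound x A M j) t0 h1 h2 => t t0 h1 h2.
have -> : t = t `^ nu * t `^ (1 - nu).
  rewrite -powRD ?subrKC ?powRr1//.
  by rewrite oner_eq0.
apply: (@le_trans _ _ ((2 `^ e) `^ nu * (A * 2 `^ (- (M%:~R * b))) `^ (1 - nu))).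
  apply: ler_pM; rewrite ?powR_ge0//.
    by rewrite ge0_ler_powR ?nnegrE ?powR_ge0// ltW.
  by rewrite ge0_ler_powR ?nnegrE ?mulr_ge0 ?powR_ge0 ?subr_ge0 ?(ltW nu1).
rewrite powRM ?powR_ge0// -exp2D -!powRrM.
set k := A `^ (1 - nu).
rewrite [leLHS](_ : _ = k * 2 `^ (e * nu + - (M%:~R * b) * (1 - nu))); last first.
  by rewrite exp2D; ring.
rewrite [leRHS](_ : _ = k * 2 `^ (1 + - (M%:~R * b) + (j%:~R + N%:~R * a) * nu
    + - c * dist N M)); last by rewrite !exp2D powRr1//; ring.
rewrite ler_wpM2l ?powR_ge0// ler_exp2 /e /c; lra.
Qed.

Lemma piece_bound_sum_le : exists2 C : R, 0 < C & forall x A (z : int -> R) (M : int),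
  (forall j, 0 <= x j) -> 0 <= A -> (forall N, 0 <= z N) ->
  (forall j N, 2 `^ N%:~R <= x j -> 2 `^ j%:~R * 2 `^ (N%:~R * a) <= z N) ->
  (\esum_(j in [set: int]) (piece_bound x A M j)%:E <=
   (C * A `^ (1 - nu) * 2 `^ (- (M%:~R * b)))%:E *
   \esum_(N in [set: int]) (z N `^ nu * 2 `^ (- c * dist N M))%:E)%E.
Proof.
move: nu01 => /andP[nu0 nu1].
have [C C0 hC] := exp2_cut_sum_le nu0.
exists (2 * C); first by rewrite mulr_gt0.
move=> x A z M x0 A0 z0 xz.
pose D : R := 2 * A `^ (1 - nu) * 2 `^ (- (M%:~R * b)).
have D0 : 0 <= D by rewrite !mulr_ge0 ?powR_ge0.
pose g N := D * 2 `^ (N%:~R * a * nu) * 2 `^ (- c * dist N M).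
have g0 N : 0 <= g N by rewrite !mulr_ge0 ?powR_ge0.
pose h (N j : int) : \bar R :=
  ((g N)%:E * (if 2 `^ N%:~R <= x j then 2 `^ (j%:~R * nu) else 0)%:E)%E.
have h0 N j : (0 <= h N j)%E.
  by rewrite /h -EFinM lee_fin mulr_ge0//; case: ifP; rewrite ?powR_ge0.
apply: (@le_trans _ _ (\esum_(j in [set: int]) \esum_(N in [set: int]) h N j)%E).
  apply: le_esum => j _.
  have [xj0|xjn0] := eqVneq (x j) 0.
    (* as a0 and a1 differ, one of the powers of x_j = 0 has a nonzero exponent *)
    apply: (@le_trans _ _ 0%E); last exact: esum_ge0.
    rewrite lee_fin /piece_bound xj0 ge_min; apply/orP; left; rewrite ge_min.
    have [a00|a0n] := eqVneq a0 0; last by rewrite powR0// mulr0 mul0r lexx.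
    by rewrite (@powR0 _ a1) ?mulr0 ?mul0r ?lexx ?orbT// -a00 eq_sym.
  have [|N xN] := @exp2_itv R (x j); first by rewrite lt_def xjn0 x0.
  apply: le_trans (@esum_term_le _ _ (h^~ j) N _); last by [].
  rewrite /h -EFinM lee_fin (le_trans (piece_bound_le M A0 xN))//.
  case/andP: xN => -> _; rewrite /g -/D powRM ?powR_ge0// -!powRrM.
  by rewrite le_eqVlt; apply/orP; left; apply/eqP; ring.
rewrite esum_exchange//.
rewrite -esumZl; first last.
- by move=> N; rewrite lee_fin mulr_ge0// powR_ge0.
- by rewrite !mulr_ge0 ?powR_ge0 ?(ltW C0).
apply: le_esum => N _.
rewrite esumZl//; last by move=> j; rewrite lee_fin; case: ifP; rewrite ?powR_ge0.
have zN0 : 0 <= z N * 2 `^ (- (N%:~R * a)) by rewrite mulr_ge0 ?powR_ge0.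
have hS (j : int) : 2 `^ N%:~R <= x j -> 2 `^ j%:~R <= z N * 2 `^ (- (N%:~R * a)).
  by move=> /xz; rewrite powRN ler_pdivlMr ?exp2_gt0.
have g0' : (0 <= (g N)%:E :> \bar R)%E by rewrite lee_fin.
apply: le_trans (lee_wpmul2l g0' (hC (fun j => 2 `^ N%:~R <= x j) _ zN0 hS)) _.
rewrite -!EFinM lee_fin powRM ?powR_ge0// -powRrM mulNr powRN /g.
rewrite le_eqVlt; apply/orP; left; apply/eqP; rewrite /D; field.
by rewrite gt_eqF// exp2_gt0.
Qed.

(** The powers of y_i are sums over the levels 2^M below y_i; for a given M the
    admissible 2^i are bounded by a multiple of 2^(-M b) V_M, with V the
    image of z^nu under the kernel, so that their sum is geometric. *)
Lemma interpolation_sum v K : 0 < v -> u <= nu * v -> 0 < K -> exists2 C : R, 0 < C &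
  forall x A B y, (forall j, 0 <= x j) -> 0 <= A -> 0 <= B -> (forall i, 0 <= y i)%E ->
  (\esum_(j in [set: int]) (2 `^ (j%:~R * u) * x j `^ (a * u))%:E <= (B `^ u)%:E)%E ->
  (forall i M : int, (2 `^ M%:~R)%:E <= y i ->
     (2 `^ i%:~R)%:E <= K%:E * \esum_(j in [set: int]) (piece_bound x A M j)%:E)%E ->
  (\esum_(i in [set: int]) ((2 `^ (i%:~R * v))%:E * y i `^ (b * v))
     <= ((C * A `^ (1 - nu) * B `^ nu) `^ v)%:E)%E.
Proof.
move=> v0 uv K0; have nu0 : 0 < nu by case/andP: nu01.
have bv0 : 0 < b * v by rewrite mulr_gt0.
have [C1 C10 hC1] := level_profile a_gt0 u_gt0.
have [C2 C20 hC2] := piece_bound_sum_le.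
have [C3 C30 hC3] := schur_exp2 al_neq0 be_neq0 c_gt0 v0.
have [C4 C40 hC4] := exp2_cut_sum_le v0.
pose p := nu * v / u.
have p1 : 1 <= p by rewrite /p ler_pdivlMr// mul1r.
pose C5 := (K * C2 * C3) `^ v * C4 * 2 `^ (b * v) * C3 * C1 `^ p.
have C50 : 0 < C5 by rewrite !mulr_gt0 ?powR_gt0// !mulr_gt0.
exists (C5 `^ v^-1); first by rewrite powR_gt0.
move=> x A B y x0 A0 B0 y0 xB H.
have [z [z0 xz zB]] := hC1 x (B `^ u) x0 xB.
have Bu0 : 0 <= C1 * B `^ u by rewrite mulr_ge0 ?powR_ge0 ?(ltW C10).
have znu : (\esum_(N in [set: int]) ((z N `^ nu) `^ v)%:E <= (C1 `^ p * B `^ (nu * v))%:E)%E.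
  have h := @esum_powR_le R (fun N => z N `^ u) p _ p1 Bu0 (fun N => powR_ge0 _ _) zB.
  have up : u * p = nu * v by rewrite /p; field; rewrite gt_eqF.
  rewrite powRM ?powR_ge0 ?(ltW C10)// -powRrM up in h.
  have E N : (z N `^ nu) `^ v = (z N `^ u) `^ p by rewrite -!powRrM up.
  by under eq_esum do rewrite E.
have [V [V0 zV VB]] := hC3 (fun N => z N `^ nu) _ (fun N => powR_ge0 _ _) znu.
pose L := K * C2 * C3 * A `^ (1 - nu).
have L0 : 0 <= L by rewrite !mulr_ge0 ?powR_ge0 ?ltW.
have HV (i M : int) : ((2 `^ M%:~R)%:E <= y i)%E -> 2 `^ i%:~R <= L * V M * 2 `^ (- (M%:~R * b)).
  move=> /H h; rewrite -lee_fin (le_trans h)//.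
  have K0' : (0 <= K%:E)%E by rewrite lee_fin ltW.
  apply: le_trans (lee_wpmul2l K0' (hC2 x A z M x0 A0 z0 xz)) _.
  have g0 : (0 <= (K * (C2 * A `^ (1 - nu) * 2 `^ (- (M%:~R * b))))%:E)%E.
    by rewrite lee_fin !mulr_ge0 ?powR_ge0 ?ltW.
  rewrite muleA -EFinM; apply: le_trans (lee_wpmul2l g0 (zV M)) _.
  rewrite -EFinM lee_fin /L le_eqVlt; apply/orP; left; apply/eqP; ring.
pose w (i M : int) : \bar R :=
  (((2 `^ (i%:~R * v))%:E * (2 `^ (b * v))%:E) *
   (if ((2 `^ M%:~R)%:E <= y i)%E then 2 `^ (M%:~R * (b * v)) else 0)%:E)%E.
have w0 i M : (0 <= w i M)%E.
  by rewrite /w !mule_ge0// lee_fin; [case: ifP|..]; rewrite ?powR_ge0.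
apply: (@le_trans _ _ (\esum_(i in [set: int]) \esum_(M in [set: int]) w i M)%E).
  apply: le_esum => i _; rewrite /w esumZl ?mulr_ge0 ?powR_ge0//; last first.
    by move=> M; rewrite lee_fin; case: ifP; rewrite ?powR_ge0.
  rewrite EFinM -muleA; apply: lee_wpmul2l; first by rewrite lee_fin powR_ge0.
  exact: poweR_le_exp2_sum.
rewrite esum_exchange//.
apply: (@le_trans _ _ (\esum_(M in [set: int]) ((L `^ v * C4 * 2 `^ (b * v))%:E * (V M `^ v)%:E))%E).
  apply: le_esum => M _.
  pose q := L * V M * 2 `^ (- (M%:~R * b)).
  have q0 : 0 <= q by rewrite /q mulr_ge0 ?powR_ge0// mulr_ge0.
  have h := hC4 (fun i => ((2 `^ M%:~R)%:E <= y i)%E) q q0 (fun i => @HV i M).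
  have g0 : (0 <= ((2 `^ (b * v)) * 2 `^ (M%:~R * (b * v)))%:E)%E.
    by rewrite lee_fin mulr_ge0 ?powR_ge0.
  apply: le_trans (le_trans (lee_wpmul2l g0 h) _).
    rewrite -esumZl ?mulr_ge0 ?powR_ge0//; last first.
      by move=> i; rewrite lee_fin; case: ifP; rewrite ?powR_ge0.
    apply: le_esum => i _; rewrite /w -!EFinM lee_fin.
    case: ifP => _; rewrite ?mulr0// le_eqVlt; apply/orP; left; apply/eqP; ring.
  have -> : q `^ v = L `^ v * V M `^ v / 2 `^ (M%:~R * (b * v)).
    rewrite /q (powRM _ (mulr_ge0 L0 (V0 M)) (powR_ge0 _ _)) (powRM _ L0 (V0 M)).
    by rewrite -powRrM mulNr powRN mulrA.
  rewrite -!EFinM lee_fin.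
  rewrite le_eqVlt; apply/orP; left; apply/eqP; field.
  by rewrite gt_eqF// exp2_gt0.
rewrite esumZl; first last.
- by move=> M; rewrite lee_fin powR_ge0.
- by rewrite !mulr_ge0 ?powR_ge0 ?ltW.
have g0 : (0 <= (L `^ v * C4 * 2 `^ (b * v))%:E)%E.
  by rewrite lee_fin !mulr_ge0 ?powR_ge0 ?ltW.
apply: le_trans (lee_wpmul2l g0 VB) _.
have K23 : 0 <= K * C2 * C3 by rewrite !mulr_ge0 ?(ltW K0) ?(ltW C20) ?(ltW C30).
have A'0 : 0 <= A `^ (1 - nu) by exact: powR_ge0.
have B'0 : 0 <= B `^ nu by exact: powR_ge0.
have -> : L `^ v = (K * C2 * C3) `^ v * (A `^ (1 - nu)) `^ v by rewrite /L powRM.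
have C5'0 : 0 <= C5 `^ v^-1 by exact: powR_ge0.
rewrite -EFinM lee_fin (powRM _ (mulr_ge0 C5'0 A'0) B'0) (powRM _ C5'0 A'0).
rewrite -!powRrM mulVf ?gt_eqF// powRr1 ?(ltW C50)// /C5.
by rewrite le_eqVlt; apply/orP; left; apply/eqP; ring.
Qed.

Lemma interpolation_sup K : 0 < K -> exists2 C : R, 0 < C &
  forall x A B y, (forall j, 0 <= x j) -> 0 <= A -> 0 <= B -> (forall i, 0 <= y i)%E ->
  (\esum_(j in [set: int]) (2 `^ (j%:~R * u) * x j `^ (a * u))%:E <= (B `^ u)%:E)%E ->
  (forall i M : int, (2 `^ M%:~R)%:E <= y i ->
     (2 `^ i%:~R)%:E <= K%:E * \esum_(j in [set: int]) (piece_bound x A M j)%:E)%E ->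
  forall i : int, ((2 `^ i%:~R)%:E * y i `^ b <= (C * A `^ (1 - nu) * B `^ nu)%:E)%E.
Proof.
move=> K0; have nu0 : 0 < nu by case/andP: nu01.
have [C1 C10 hC1] := level_profile a_gt0 u_gt0.
have [C2 C20 hC2] := piece_bound_sum_le.
have [C3 C30 hC3] := affine_peak_sum_le al_neq0 c_gt0.
pose C5 := K * C2 * C3 * C1 `^ (nu / u) * 2 `^ b.
have C50 : 0 < C5 by rewrite !mulr_gt0 ?powR_gt0.
exists C5 => // x A B y x0 A0 B0 y0 xB H i.
have [z [z0 xz zB]] := hC1 x (B `^ u) x0 xB.
have zB' N : z N `^ nu <= C1 `^ (nu / u) * B `^ nu.
  have : z N `^ u <= C1 * B `^ u.
    rewrite -lee_fin; apply: le_trans zB.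
    by apply: (@esum_term_le _ _ (fun N => (z N `^ u)%:E)) => k; rewrite lee_fin powR_ge0.
  move=> /(@ge0_ler_powR _ (nu / u)); rewrite !nnegrE.
  rewrite divr_ge0 ?(ltW nu0) ?(ltW u_gt0)// mulr_ge0 ?powR_ge0 ?(ltW C10)//.
  move=> /(_ isT isT isT).
  by rewrite powRM ?powR_ge0 ?(ltW C10)// -!powRrM mulrC divfK ?gt_eqF// mulrC.
pose L := K * C2 * C3 * C1 `^ (nu / u) * A `^ (1 - nu) * B `^ nu.
have L0 : 0 <= L by rewrite !mulr_ge0 ?powR_ge0 ?ltW.
have HL (M : int) : ((2 `^ M%:~R)%:E <= y i)%E -> 2 `^ i%:~R * 2 `^ (M%:~R * b) <= L.
  move=> /H h; rewrite -ler_pdivlMr ?exp2_gt0// -powRN -lee_fin (le_trans h)//.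
  have K0' : (0 <= K%:E)%E by rewrite lee_fin ltW.
  apply: le_trans (lee_wpmul2l K0' (hC2 x A z M x0 A0 z0 xz)) _.
  have g0 : (0 <= (K * (C2 * A `^ (1 - nu) * 2 `^ (- (M%:~R * b))))%:E)%E.
    by rewrite lee_fin !mulr_ge0 ?powR_ge0 ?ltW.
  have hz : (\esum_(N in [set: int]) (z N `^ nu * 2 `^ (- c * dist N M))%:E <=
     (C1 `^ (nu / u) * B `^ nu * C3)%:E)%E.
    have g1 : (0 <= (C1 `^ (nu / u) * B `^ nu)%:E)%E by rewrite lee_fin mulr_ge0 ?powR_ge0.
    rewrite EFinM; apply: le_trans (lee_wpmul2l g1 (hC3 (be * M%:~R))).
    rewrite -esumZl ?mulr_ge0 ?powR_ge0//; apply: le_esum => N _.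
    by rewrite lee_fin ler_wpM2r ?powR_ge0.
  rewrite muleA -EFinM; apply: le_trans (lee_wpmul2l g0 hz) _.
  rewrite -EFinM lee_fin /L le_eqVlt; apply/orP; left; apply/eqP; ring.
have L0' : 0 <= C5 * A `^ (1 - nu) * B `^ nu by rewrite !mulr_ge0 ?powR_ge0 ?ltW.
move: (y0 i) HL; case: (y i) => [r|_|//]; last first.
  move=> HL; exfalso; have [M] := exp2_unbounded b_gt0 (L / 2 `^ i%:~R + 1).
  apply/negP; rewrite -ltNge (@le_lt_trans _ _ (L / 2 `^ i%:~R))//.
    by rewrite ler_pdivlMr ?exp2_gt0// mulrC HL// leey.
  by rewrite ltrDl.
rewrite lee_fin le_eqVlt => /predU1P[<-|r0] HL.
  by rewrite poweR0r ?gt_eqF// mule0 lee_fin.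
have [M /andP[Mr rM]] := exp2_itv r0.
have {}HL := HL M; rewrite lee_fin in HL; have {}HL := HL Mr.
rewrite poweR_EFin -EFinM lee_fin.
apply: (@le_trans _ _ (2 `^ i%:~R * (2 `^ (M%:~R * b) * 2 `^ b))).
  rewrite ler_wpM2l ?powR_ge0// -exp2D -[X in _ + X]mul1r -mulrDl powRrM.
  by rewrite ge0_ler_powR ?nnegrE ?powR_ge0 ?ltW.
rewrite mulrA (le_trans (ler_wpM2r _ HL)) ?powR_ge0// /L /C5.
by rewrite le_eqVlt; apply/orP; left; apply/eqP; ring.
Qed.

End interpolation.

(** * Lorentz quasi-norms as dyadic sums *)

Section dyadic.
Variable R : realType.
Local Notation leb := (@lebesgue_measure R).

Definition dyadic (i : int) : set R := `[2 `^ i%:~R, 2 `^ (i%:~R + 1)[%classic.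
Local Notation I := dyadic.

Let mI i : measurable (I i). Proof. exact: measurable_itv. Qed.

Let I_gt0 i s : I i s -> 0 < s.
Proof. by rewrite /dyadic/= in_itv/= => /andP[+ _]; apply: lt_le_trans; exact: exp2_gt0. Qed.

Let I_uniq i j s : I i s -> I j s -> i = j.
Proof.
rewrite /dyadic/= !in_itv/= => /andP[i1 i2] /andP[j1 j2].
have := le_lt_trans i1 j2; have := le_lt_trans j1 i2.
rewrite !ltr_exp2 -!(intrD _ _ 1) !ltr_int !ltzD1 => ji ij.
by apply/eqP; rewrite eq_le ij ji.
Qed.

Lemma integral_dyadic (h : R -> \bar R) :
  measurable_fun (`]0, +oo[%classic : set R) h -> (forall s, 0 < s -> (0 <= h s)%E) ->
  (\int[leb]_(s in `]0%R, +oo[) h s =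
   \esum_(i in [set: int]) \int[leb]_(s in dyadic i) h s)%E.
Proof.
move=> mh h0; rewrite esum_int; last first.
  by move=> i; apply: integral_ge0 => s /I_gt0; exact: h0.
pose F (m : nat) := I (Posz m) `|` I (Negz m).
have mF m : measurable (F m) by exact: measurableU.
have FE : (`]0%R, +oo[%classic : set R) = \bigcup_m F m.
  apply/seteqP; split=> [s|s [m _ [|]/I_gt0]]/=; rewrite ?in_itv/= ?andbT//.
  move=> s0; have [[m|m] sN] := exp2_itv s0; exists m => //; [left|right];
    by rewrite /dyadic/= in_itv.
rewrite FE in mh *.
rewrite ge0_integral_bigcup//; last 2 first.
- by move=> s [m _ [|]/I_gt0]; exact: h0.
- apply/trivIsetP => i j _ _ ij; apply/seteqP; split=> // s [Fi Fj].
  case/eqP: ij.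
  by case: Fi => Is; case: Fj => /(I_uniq Is) [].
apply: eq_eseriesr => m _; rewrite ge0_integral_setU//.
- exact: mI.
- exact: mI.
- by apply: measurable_funS mh; [exact: bigcup_measurable|move=> s Fs; exists m].
- by move=> s [|]/I_gt0; exact: h0.
- by apply/disj_setPS => s [/I_uniq Is /Is].
Qed.

Lemma measure_dyadic (i : int) : leb (I i) = (2 `^ i%:~R)%:E.
Proof.
rewrite /dyadic lebesgue_measure_itv/= lte_fin ltr_exp2 ltrDl ltr01 -EFinD; congr EFin.
by rewrite exp2D powRr1//; lra.
Qed.

Lemma measurable_nonincreasing (d : R -> \bar R) :
  {homo d : s t / s <= t >-> (t <= s)%E} -> measurable_fun setT d.
Proof.
move=> dd; apply: (measurability (@ErealGenCInfty.G R)) => [|/= _ [_] [r] -> <-].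
  exact: ErealGenCInfty.measurableE.
rewrite setTI; apply: is_interval_measurable => s t/=.
rewrite !in_itv/= !andbT => fs ft u /andP[su ut].
by rewrite in_itv/= andbT (le_trans ft)// dd.
Qed.

Section weighted.
Variables (d : R -> \bar R) (b r : R).
Hypotheses (d_ge0 : forall s, (0 <= d s)%E) (d_noninc : {homo d : s t / s <= t >-> (t <= s)%E}).
Hypotheses (b_gt0 : 0 < b) (r_gt0 : 0 < r).
Let h (s : R) : \bar R := ((s%:E * d s `^ b) `^ r * (s^-1)%R%:E)%E.

Let mh (D : set R) : measurable D -> (forall s, D s -> 0 < s) -> measurable_fun D h.
Proof.
move=> mD D0.
pose g (s : R) : \bar R := ((s%:E * d s `^ b) `^ r * (s `^ (-1))%:E)%E.
apply: (eq_measurable_fun g) => [s|].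
  by rewrite inE => /D0 s0; rewrite /g /h powR_inv1// ltW.
apply: (@measurable_funS _ _ _ _ setT) => //; apply: emeasurable_funM.
  apply: (measurableT_comp (measurable_poweR _)).
  apply: emeasurable_funM; first exact/measurable_EFinP.
  apply: (measurableT_comp (measurable_poweR _)).
  exact: measurable_nonincreasing.
by apply/measurable_EFinP; exact: measurable_powR.
Qed.

Let mhI i : measurable_fun (I i) h.
Proof. by apply: mh => [|s /I_gt0]; first exact: mI. Qed.

Let mh0 : measurable_fun (`]0, +oo[%classic : set R) h.
Proof. by apply: mh => // s; rewrite /= in_itv/= andbT. Qed.

Let h0 s : 0 < s -> (0 <= h s)%E.
Proof. by move=> s0; rewrite mule_ge0 ?poweR_ge0// lee_fin invr_ge0 ltW. Qed.

Let pow_mono (x y : \bar R) e : 0 < e -> (0 <= x)%E -> (x <= y)%E -> (x `^ e <= y `^ e)%E.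
Proof.
move=> e0 x0 xy; apply: gt0_ler_poweR; rewrite ?(ltW e0)// in_itv/= leey andbT//.
exact: le_trans xy.
Qed.

Lemma dyadic_sum_le_integral :
  (\esum_(i in [set: int]) ((2 `^ (i%:~R * r))%:E * d (2 `^ i%:~R) `^ (b * r)) <=
   (2 `^ r * 2)%:E * \int[leb]_(s in `]0%R, +oo[) h s)%E.
Proof.
rewrite (integral_dyadic mh0 h0) (esum_int_shift 1).
rewrite -esumZl ?mulr_ge0 ?powR_ge0//; last first.
  by move=> i; apply: integral_ge0 => s /I_gt0; exact: h0.
apply: le_esum => i _; rewrite intrD.
pose k : \bar R := ((2 `^ (i%:~R * r - i%:~R - 1))%:E * d (2 `^ (i%:~R + 1)) `^ (b * r))%E.
apply: (@le_trans _ _ ((2 `^ r * 2)%:E * \int[leb]_(s in I i) cst k s)%E); last first.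
  rewrite lee_pmul2l ?fin_numE ?lte_fin ?mulr_gt0 ?exp2_gt0//.
  apply: ge0_le_integral => //.
  - exact: mI.
  - by move=> s _; rewrite /= /k mule_ge0 ?lee_fin ?poweR_ge0 ?powR_ge0.
  - exact: mhI.
  move=> s Is; have s0 := I_gt0 Is; move: Is; rewrite /dyadic/= in_itv/= => /andP[s1 s2].
  rewrite /h /k.
  rewrite -addrA exp2D EFinM (poweRrM (d _) b r) muleAC.
  apply: lee_pmul => //; rewrite ?lee_fin ?powR_ge0 ?poweR_ge0 ?mule_ge0 ?lee_fin ?powR_ge0 ?poweR_ge0//.
    rewrite powRrM -poweR_EFin -poweRM ?poweR_ge0 ?lee_fin ?powR_ge0//.
    apply: pow_mono => //; first by rewrite mule_ge0 ?poweR_ge0 ?lee_fin ?powR_ge0.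
    apply: lee_pmul; rewrite ?poweR_ge0 ?lee_fin ?powR_ge0//.
    by apply: pow_mono => //; apply: d_noninc; exact: ltW.
  rewrite -opprD powRN lef_pV2 ?posrE ?exp2_gt0//; exact: ltW.
have -> : (\int[leb]_(s in I i) cst k s = k * (2 `^ i%:~R)%:E)%E.
  by rewrite integral_cst; [congr (_ * _)%E; exact: measure_dyadic|exact: mI].
rewrite /k.
rewrite muleAC -EFinM muleA -EFinM lee_wpmul2r ?poweR_ge0// lee_fin.
rewrite -[X in _ <= _ * X * _](powRr1 (ler0n R 2)).
rewrite -!exp2D ler_exp2; lra.
Qed.

Lemma integral_le_dyadic_sum :
  (\int[leb]_(s in `]0%R, +oo[) h s <= (2 `^ r)%:E *
   \esum_(i in [set: int]) ((2 `^ (i%:~R * r))%:E * d (2 `^ i%:~R) `^ (b * r)))%E.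
Proof.
rewrite (integral_dyadic mh0 h0).
rewrite -esumZl ?powR_ge0//; last first.
  by move=> i; rewrite mule_ge0 ?poweR_ge0 ?lee_fin ?powR_ge0.
apply: le_esum => i _.
pose k : \bar R := ((2 `^ ((i%:~R + 1) * r - i%:~R))%:E * d (2 `^ i%:~R) `^ (b * r))%E.
apply: (@le_trans _ _ (\int[leb]_(s in I i) cst k s)%E).
  apply: ge0_le_integral => //.
  - exact: mI.
  - by move=> s /I_gt0; exact: h0.
  - exact: mhI.
  move=> s Is; have s0 := I_gt0 Is; move: Is; rewrite /dyadic/= in_itv/= => /andP[s1 s2].
  rewrite /h /k.
  rewrite exp2D EFinM (poweRrM (d _) b r) muleAC.
  apply: lee_pmul; rewrite ?lee_fin ?powR_ge0 ?poweR_ge0 ?invr_ge0 ?(ltW s0)//.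
    rewrite powRrM -poweR_EFin -poweRM ?poweR_ge0 ?lee_fin ?powR_ge0//.
    apply: pow_mono => //; first by rewrite mule_ge0 ?poweR_ge0 ?lee_fin ?(ltW s0).
    apply: lee_pmul; rewrite ?poweR_ge0 ?lee_fin ?(ltW s0) ?(ltW s2)//.
    by apply: pow_mono => //; apply: d_noninc.
  by rewrite powRN lef_pV2 ?posrE ?exp2_gt0.
have -> : (\int[leb]_(s in I i) cst k s = k * (2 `^ i%:~R)%:E)%E.
  by rewrite integral_cst; [congr (_ * _)%E; exact: measure_dyadic|exact: mI].
rewrite /k.
rewrite muleAC -EFinM muleA -EFinM lee_wpmul2r ?poweR_ge0// lee_fin.
rewrite -!exp2D ler_exp2; lra.
Qed.

End weighted.
End dyadic.

(** * Hölder's inequality for weak Lebesgue spaces *)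

Section weak_type.
Context d (T : measurableType d) (R : realType) (mu : {measure set T -> \bar R}).
Implicit Types (g : T -> R) (F D : set T).

Lemma ge0_integral_esum_int D (h : int -> T -> \bar R) : measurable D ->
  (forall i, measurable_fun D (h i)) -> (forall i x, (0 <= h i x)%E) ->
  measurable_fun D (fun x => \esum_(i in [set: int]) h i x) /\
  (\int[mu]_(x in D) (\esum_(i in [set: int]) h i x) =
   \esum_(i in [set: int]) \int[mu]_(x in D) h i x)%E.
Proof.
move=> mD mh h0.
have E x : ((\esum_(i in [set: int]) h i x) = \sum_(0 <= m <oo) (h (Posz m) x + h (Negz m) x))%E.
  by rewrite esum_int.
have hm (m : nat) : measurable_fun D (fun x => h (Posz m) x + h (Negz m) x)%E.
  exact: emeasurable_funD.
split.
  under eq_fun do rewrite E.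
  apply: ge0_emeasurable_sum => // m x _ _.
  exact: adde_ge0.
under eq_integral do rewrite E.
rewrite integral_nneseries//; last by move=> m x _; exact: adde_ge0.
rewrite esum_int; last by move=> i; exact: integral_ge0.
by apply: eq_eseriesr => m _; rewrite ge0_integralD.
Qed.

Lemma measurable_superlevel g s : measurable_fun setT g -> measurable [set x | s < g x].
Proof.
move=> mg; have := mg measurableT _ (measurable_itv `]s, +oo[).
by rewrite setTI (_ : _ @^-1` _ = [set x | s < g x])//; apply/seteqP; split=> x /=; rewrite in_itv/= andbT.
Qed.

(** The two affine functions of i agree at i = al - t b, with value
    al + t (1 - b); the slopes are 1 on its left and 1 - 1/b on its right. *)
Lemma min_affine_le_peak (b al t : R) (i : int) : 0 < b ->
  Num.min (i%:~R + t) (i%:~R + (al - i%:~R) / b) <=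
  al + t * (1 - b) - Num.min 1 (b^-1 - 1) * `|i%:~R - (al - t * b)|.
Proof.
move=> b0; set c := Num.min 1 _; move: (i%:~R : R) => x.
have [h|h] := leP x (al - t * b).
  rewrite ge_min ler0_norm ?subr_le0//; apply/orP; left.
  have : c * (al - t * b - x) <= 1 * (al - t * b - x).
    by rewrite ler_wpM2r ?subr_ge0// ge_min lexx.
  lra.
rewrite ge_min gtr0_norm ?subr_gt0//; apply/orP; right.
have : c * (x - (al - t * b)) <= (b^-1 - 1) * (x - (al - t * b)).
  by rewrite ler_wpM2r ?subr_ge0 ?(ltW h)// ge_min lexx orbT.
rewrite [X in _ <= X -> _](_ : _ = (x - al) / b + t - (x - (al - t * b))); last first.
  by field; rewrite gt_eqF.
rewrite mulrBl mulrBl; lra.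
Qed.

Lemma le_of_weak_bound (b A : R) (i : int) (m : \bar R) : 0 < b -> 0 <= A -> (0 <= m)%E ->
  ((2 `^ i%:~R)%:E * m `^ b <= A%:E)%E -> (m <= ((A * 2 `^ (- i%:~R)) `^ b^-1)%:E)%E.
Proof.
move=> b0 A0; case: m => [m|_|//]; last first.
  by rewrite poweRyr ?gt_eqF// gt0_muley ?lte_fin ?exp2_gt0.
rewrite lee_fin => m0; rewrite poweR_EFin -EFinM !lee_fin => mA.
have -> : m = (m `^ b) `^ b^-1 by rewrite -powRrM mulfV ?gt_eqF// powRr1.
rewrite ge0_ler_powR ?nnegrE ?powR_ge0 ?invr_ge0 ?(ltW b0) ?mulr_ge0 ?powR_ge0//.
by rewrite powRN ler_pdivlMr ?exp2_gt0// mulrC.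
Qed.

End weak_type.

(** The function g is at most the sum over i of 4 2^i on the set where g > 2^i.
    That set meets F in measure at most the minimum of t and (A 2^-i)^(1/b), so
    the summand is a peak in i of height A t^(1-b), centred where the two
    numbers agree. It decays on the right of its centre because 1/b > 1. *)
Lemma integral_le_weak_norm (R : realType) (b : R) : 0 < b < 1 -> exists2 C : R, 0 < C &
  forall d (T : measurableType d) (mu : {measure set T -> \bar R}) (g : T -> R) F A t,
  measurable_fun setT g -> (forall x, 0 <= g x) -> measurable F ->
  0 <= A -> 0 < t -> mu F = t%:E ->
  (forall i : int, (2 `^ i%:~R)%:E * mu [set x | (2 `^ i%:~R < g x)%R] `^ b <= A%:E)%E ->
  (\int[mu]_(x in F) (g x)%:E <= (C * A * t `^ (1 - b))%:E)%E.
Proof.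
move=> /andP[b0 b1]; pose c := Num.min 1 (b^-1 - 1).
have c0 : 0 < c by rewrite lt_min ltr01 subr_gt0 invf_gt1.
have [C C0 hC] := peak_sum_le c0.
exists (4 * C); first by rewrite mulr_gt0.
move=> d T mu g F A t mg g0 mF A0 t0 Ft gA.
pose h (i : int) (x : T) : \bar R := (4 * 2 `^ i%:~R * \1_[set x | (2 `^ i%:~R < g x)%R] x)%:E.
have h0 i x : (0 <= h i x)%E by rewrite lee_fin !mulr_ge0 ?powR_ge0.
have mh i : measurable_fun F (h i).
  apply: (@measurable_funS _ _ _ _ setT) => //; apply/measurable_EFinP.
  apply: measurable_funM => //; apply: measurable_indic; exact: measurable_superlevel.
have [mS iS] := ge0_integral_esum_int mu mF mh h0.
apply: (@le_trans _ _ (\int[mu]_(x in F) (\esum_(i in [set: int]) h i x))%E).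
  apply: ge0_le_integral => //.
  - by move=> x _; rewrite lee_fin.
  - by apply/measurable_EFinP; exact: measurable_funS mg.
  move=> x _; have := g0 x; rewrite le_eqVlt => /predU1P[<-|gx0].
    by apply: esum_ge0.
  have [N /andP[N1 N2]] := exp2_itv gx0.
  apply: le_trans (@esum_term_le _ _ (h^~ x) (N - 1) _) => //.
  rewrite /h indicE mem_set/=; last first.
    rewrite (lt_le_trans _ N1)// ltr_exp2 intrB; lra.
  rewrite lee_fin mulr1 (le_trans (ltW N2))//.
  have -> : 4 = 2 `^ 2 :> R by rewrite powR_mulrn// expr2; lra.
  rewrite -exp2D ler_exp2 intrB; lra.
rewrite iS.
have hi i : (\int[mu]_(x in F) h i x <=
    (4 * 2 `^ i%:~R)%:E * mu (F `&` [set x | (2 `^ i%:~R < g x)%R]))%E.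
  rewrite (eq_integral (fun x => (4 * 2 `^ i%:~R)%:E * (\1_[set x | (2 `^ i%:~R < g x)%R] x)%:E)%E)//.
  rewrite ge0_integralZl_EFin//.
  - rewrite integral_indic//; last exact: measurable_superlevel.
    by rewrite setIC.
  apply/measurable_EFinP; apply: measurable_indic; exact: measurable_superlevel.
have m2 i : (mu (F `&` [set x | (2 `^ i%:~R < g x)%R]) <= ((A * 2 `^ (- i%:~R)) `^ b^-1)%:E)%E.
  apply: (@le_trans _ _ (mu [set x | (2 `^ i%:~R < g x)%R])).
    apply: le_measure; rewrite ?inE//; last exact: measurable_superlevel.
    by apply: measurableI => //; exact: measurable_superlevel.
  exact: le_of_weak_bound.
move: A0; rewrite le_eqVlt => /predU1P[A0|A0].
  rewrite esum1 ?lee_fin ?mulr_ge0 ?(ltW C0)// ?powR_ge0 -?A0// => i _.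
  apply/eqP; rewrite eq_le integral_ge0// andbT (le_trans (hi i))//.
  have := m2 i; rewrite -A0 mul0r powR0 ?invr_eq0 ?gt_eqF// => m0.
  by rewrite (le_trans (lee_wpmul2l _ m0)) ?mule0// lee_fin mulr_ge0 ?powR_ge0.
pose al := ln A / ln 2; pose ta := ln t / ln 2.
have Aal : 2 `^ al = A by exact: exp2_log.
have tta : 2 `^ ta = t by exact: exp2_log.
pose K := 4 * (A * t `^ (1 - b)).
have -> : (4 * C * A * t `^ (1 - b))%:E = (K%:E * C%:E)%E by rewrite -EFinM /K; congr EFin; ring.
have K0 : (0 <= K%:E)%E by rewrite lee_fin !mulr_ge0 ?powR_ge0 ?(ltW A0).
apply: le_trans (lee_wpmul2l K0 (hC (al - ta * b))).
rewrite -esumZl; [|by rewrite -lee_fin|by move=> i; rewrite lee_fin powR_ge0].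
apply: le_esum => i _; apply: le_trans (hi i) _.
have m1 : (mu (F `&` [set x | (2 `^ i%:~R < g x)%R]) <= (2 `^ ta)%:E)%E.
  rewrite tta -Ft; apply: le_measure; rewrite ?inE//.
  by apply: measurableI => //; exact: measurable_superlevel.
have {}m2 : (mu (F `&` [set x | (2 `^ i%:~R < g x)%R]) <= (2 `^ ((al - i%:~R) / b))%:E)%E.
  by have := m2 i; rewrite -Aal -exp2D -powRrM.
rewrite -EFinM.
apply: (@le_trans _ _ (4 * 2 `^ Num.min (i%:~R + ta) (i%:~R + (al - i%:~R) / b))%:E).
  rewrite !EFinM -muleA lee_pmul2l// minEle; case: ifPn => _; rewrite exp2D EFinM lee_pmul2l// lte_fin exp2_gt0//.
rewrite lee_fin /K -mulrA ler_pM2l// -Aal -tta -powRrM -!exp2D ler_exp2.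
by apply: le_trans (min_affine_le_peak _ _ _ b0) _; rewrite /c mulNr.
Qed.

(** * Lorentz quasi-norms on R^n *)

Section lorentz.
Variables (R : realType) (n : nat).
Local Notation cabs := (@ComplexField.Normc.normc R).
Implicit Types (f : Rn R n -> R[i]) (p r L : R).

Lemma measurable_cabs f : cmeasurable f -> measurable_fun setT (fun x => cabs (f x)).
Proof.
move=> [mRe mIm].
rewrite (_ : (fun x => _) =
  Num.sqrt \o (fun x => complex.Re (f x) ^+ 2 + complex.Im (f x) ^+ 2)); last first.
  by apply/funext => x /=; case: (f x).
apply: (measurableT_comp (continuous_measurable_fun (@sqrt_continuous R))).
by apply: measurable_funD; exact: measurable_funX.
Qed.

Lemma cabs_ge0 (z : R[i]) : 0 <= cabs z.
Proof. by case: z => a b; exact: sqrtr_ge0. Qed.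

Lemma distribution_function_ge0 f s : (0 <= distribution_function f s)%E.
Proof. exact: measure_ge0. Qed.

Lemma distribution_function_noninc f : cmeasurable f ->
  {homo distribution_function f : s t / s <= t >-> (t <= s)%E}.
Proof.
move=> /measurable_cabs mf s t st; apply: le_measure; rewrite ?inE.
- exact: measurable_superlevel.
- exact: measurable_superlevel.
- by move=> x /=; apply: le_lt_trans.
Qed.

Local Notation dyadic_sum p r f := (\esum_(i in [set: int])
  ((2 `^ (i%:~R * r))%:E * distribution_function f (2 `^ i%:~R) `^ (p^-1%R * r)%R))%E.

Lemma dyadic_sum_le_lorentz p r L f : 0 < p -> 0 < r -> cmeasurable f -> 0 <= L ->
  (lorentz p r%:E f <= L%:E)%E ->
  (dyadic_sum p r f <= (2 `^ r * 2 / p * L `^ r)%:E)%E.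
Proof.
move=> p0 r0 mf L0; rewrite /lorentz.
have pV0 : 0 < p^-1 by rewrite invr_gt0.
have := dyadic_sum_le_integral (distribution_function_ge0 f) (distribution_function_noninc mf) pV0 r0.
set I := (\int[_]_(_ in _) _)%E => h fL; apply: le_trans h _.
have I0 : (0 <= I)%E.
  apply: integral_ge0 => s; rewrite /= in_itv/= andbT => s0.
  by rewrite mule_ge0 ?poweR_ge0// lee_fin invr_ge0 ltW.
have pI : (p%:E * I <= (L `^ r)%:E)%E.
  have pI0 : (0 <= p%:E * I)%E by rewrite mule_ge0// lee_fin ltW.
  have -> : (p%:E * I)%E = (((p%:E * I) `^ r^-1) `^ r)%E.
    by rewrite -poweRrM mulVf ?gt_eqF// poweRe1.
  rewrite -poweR_EFin; apply: gt0_ler_poweR; rewrite ?(ltW r0)//.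
    by rewrite in_itv/= leey andbT poweR_ge0.
  by rewrite in_itv/= leey andbT lee_fin.
have -> : (2 `^ r * 2 / p * L `^ r)%:E = ((2 `^ r * 2)%:E * (p^-1%:E * (L `^ r)%:E))%E.
  by rewrite -!EFinM mulrA.
rewrite lee_pmul2l ?fin_numE ?lte_fin ?mulr_gt0 ?exp2_gt0//.
by rewrite lee_pdivlMl// muleC.
Qed.

Lemma lorentz_le_dyadic_sum p r L f : 0 < p -> 0 < r -> cmeasurable f -> 0 <= L ->
  (dyadic_sum p r f <= (L `^ r)%:E)%E ->
  (lorentz p r%:E f <= ((p * 2 `^ r) `^ r^-1 * L)%:E)%E.
Proof.
move=> p0 r0 mf L0 fL; rewrite /lorentz.
have pV0 : 0 < p^-1 by rewrite invr_gt0.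
have := integral_le_dyadic_sum (distribution_function_ge0 f) (distribution_function_noninc mf) pV0 r0.
set I := (\int[_]_(_ in _) _)%E => h.
have I0 : (0 <= I)%E.
  apply: integral_ge0 => s; rewrite /= in_itv/= andbT => s0.
  by rewrite mule_ge0 ?poweR_ge0// lee_fin invr_ge0 ltW.
have {1}-> : L = (L `^ r) `^ r^-1 by rewrite -powRrM mulfV ?gt_eqF// powRr1.
rewrite -powRM ?powR_ge0 ?mulr_ge0 ?powR_ge0 ?(ltW p0)// -poweR_EFin.
apply: gt0_ler_poweR; first by rewrite invr_ge0 ltW.
- by rewrite in_itv/= leey andbT mule_ge0// lee_fin ltW.
- by rewrite in_itv/= leey andbT lee_fin !mulr_ge0 ?powR_ge0 ?(ltW p0).
rewrite EFinM EFinM -muleA lee_pmul2l ?lte_fin//.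
by apply: le_trans h _; apply: lee_wpmul2l.
Qed.

Lemma lorentz_sup_le p L f : 0 < p -> cmeasurable f -> 0 <= L ->
  (forall i : int, (2 `^ i%:~R)%:E * distribution_function f (2 `^ i%:~R) `^ p^-1 <= L%:E)%E ->
  (lorentz p +oo f <= (2 * L)%:E)%E.
Proof.
move=> p0 mf L0 fL; apply: ge_ereal_sup => _ [s + <-].
rewrite /= in_itv/= andbT => s0; have [i /andP[i1 i2]] := exp2_itv s0.
rewrite EFinM; apply: le_trans (lee_wpmul2l _ (fL i)); last by rewrite lee_fin.
rewrite muleA -EFinM; apply: lee_pmul; rewrite ?lee_fin ?(ltW s0) ?poweR_ge0//.
  by rewrite -[X in _ <= X * _](powRr1 (ler0n R 2)) -exp2D addrC ltW.
apply: gt0_ler_poweR; first by rewrite invr_ge0 ltW.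
- by rewrite in_itv/= leey andbT.
- by rewrite in_itv/= leey andbT.
- exact: distribution_function_noninc.
Qed.

End lorentz.

(** The embedding of L^(p,v) in weak L^p: for finite v, one term of the
    dyadic sum. *)
Lemma weak_le_lorentz (R : realType) (p : R) (v : \bar R) : 0 < p -> (1 <= v)%E ->
  exists2 C : R, 0 < C & forall (n : nat) (f : Rn R n -> R[i]) (L : R),
    cmeasurable f -> 0 <= L -> (lorentz p v f <= L%:E)%E ->
    forall i : int, ((2 `^ i%:~R)%:E * distribution_function f (2 `^ i%:~R) `^ p^-1
                       <= (C * L)%:E)%E.
Proof.
move=> p0; case: v => [r|_|//]; last first.
  exists 1 => // n f L mf L0 fL i; rewrite mul1r; apply: le_trans fL.
  by apply: ereal_sup_ubound; exists (2 `^ i%:~R) => //=; rewrite in_itv/= andbT exp2_gt0.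
rewrite lee_fin => r1; have r0 : 0 < r by rewrite (lt_le_trans _ r1).
exists ((2 `^ r * 2 / p) `^ r^-1); first by rewrite powR_gt0 ?divr_gt0 ?mulr_gt0 ?exp2_gt0.
move=> n f L mf L0 fL i.
have := dyadic_sum_le_lorentz p0 r0 mf L0 fL.
set S := (\esum_(_ in _) _)%E => SL.
have {SL} : ((2 `^ (i%:~R * r))%:E * distribution_function f (2 `^ i%:~R) `^ (p^-1 * r)%R
   <= (2 `^ r * 2 / p * L `^ r)%:E)%E.
  apply: le_trans SL.
  apply: (@esum_term_le _ _ (fun i : int =>
    (2 `^ (i%:~R * r))%:E * distribution_function f (2 `^ i%:~R) `^ (p^-1 * r)%R)%E).
  by move=> j; rewrite mule_ge0 ?poweR_ge0 ?lee_fin ?powR_ge0.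
set w := ((2 `^ i%:~R)%:E * _)%E.
have w0 : (0 <= w)%E by rewrite mule_ge0 ?poweR_ge0 ?lee_fin ?powR_ge0.
have -> : ((2 `^ (i%:~R * r))%:E * distribution_function f (2 `^ i%:~R) `^ (p^-1 * r)%R = w `^ r)%E.
  by rewrite /w poweRM ?poweR_ge0 ?lee_fin ?powR_ge0// poweRrM powRrM.
have k0 : 0 <= 2 `^ r * 2 / p by rewrite divr_ge0 ?mulr_ge0 ?powR_ge0 ?(ltW p0).
move=> h; have {1}-> : w = ((w `^ r) `^ r^-1)%E by rewrite -poweRrM mulfV ?gt_eqF// poweRe1.
have -> : L = (L `^ r) `^ r^-1 by rewrite -powRrM mulfV ?gt_eqF// powRr1.
rewrite -powRM ?powR_ge0// -poweR_EFin.
apply: gt0_ler_poweR => //; first by rewrite invr_ge0 ltW.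
  by rewrite in_itv/= leey andbT poweR_ge0.
by rewrite in_itv/= leey andbT lee_fin mulr_ge0 ?powR_ge0.
Qed.

(** * Restricted type on sets of finite measure *)

Section exhaustion.
Variables (R : realType) (n : nat).

(** Cubes, cut by an exhaustion of the Borel measure by sets of finite
    measure. *)
Lemma bounded_exhaustion : exists W : nat -> set (Rn R n),
  [/\ nondecreasing_seq W, \bigcup_m W m = setT,
      forall m, measurable (W m), forall m, bounded_subset (W m) &
      forall m, (vol R n (W m) < +oo)%E].
Proof.
have /completed_measure_extension_sigma_finite/sigma_finiteP[G [TG ndG mG]] :
  sigma_finite setT (@borel_lebesgue R n) by exact: sigma_finiteT.
pose Q (m : nat) : set (n.-tuple R) := \bigcap_(i in [set: 'I_n]) [set x | `|tnth x i| <= m%:R].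
have mQ m : measurable (Q m : set (Rn R n)).
  apply: caratheodory_measurable_mu_ext.
  apply: fin_bigcap_measurable => [|i _]; first exact: finite_finset.
  have mt : measurable_fun setT (fun x : n.-tuple R => `|tnth x i|).
    by apply: measurableT_comp => //; exact: measurable_tnth.
  have := mt measurableT _ (measurable_itv `]-oo, m%:R]).
  by rewrite setTI.
exists (fun m => G m `&` Q m); split=> [|||m|m].
- move=> m k mk; apply/subsetPset => x [Gx Qx]; split.
    by move/subsetPset : (ndG _ _ mk); apply.
  by move=> i _; rewrite /= (le_trans (Qx i _))// ler_nat.
- apply/seteqP; split=> // x _.
  have [m _ Gm] : (\bigcup_i G i) x by rewrite -TG.
  pose s := \sum_(i < n) `|tnth (x : n.-tuple R) i|.
  pose k := (maxn m (Num.bound s)).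
  exists k => //; split.
    by move/subsetPset : (ndG _ _ (leq_maxl m (Num.bound s))); apply.
  move=> i _ /=; apply: (@le_trans _ _ s).
    by rewrite /s (bigD1 i)//= lerDl sumr_ge0.
  rewrite (le_trans (ltW (archi_boundP _)))// ?sumr_ge0// ler_nat leq_maxr//.
- by move=> m; apply: measurableI; [exact: (mG m).1|exact: mQ].
- by exists m%:R => x [_ Qx] i; exact: Qx.
- apply: le_lt_trans (mG m).2; apply: le_measure; rewrite ?inE//.
  + by apply: measurableI; [exact: (mG m).1|exact: mQ].
  + exact: (mG m).1.
Qed.

Local Notation cabs := (@ComplexField.Normc.normc R).

(** Chebyshev's inequality on a bounded part of a level set, which by continuity
    from below can be taken of measure greater than any c < d_g(s). *)
Lemma superlevel_bounded_part g (s : R) (c : R) : cmeasurable g -> 0 < s ->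
  (c%:E < distribution_function g s)%E ->
  exists F t, [/\ measurable F, bounded_subset F, vol R n F = t%:E, c < t &
    ((s * t)%:E <= \int[vol R n]_(x in F) (cabs (g x))%:E)%E].
Proof.
move=> mg s0 cg; have [W [ndW TW mW bW Wfin]] := bounded_exhaustion.
have mG : measurable [set x | s < cabs (g x)].
  by apply: measurable_superlevel; exact: measurable_cabs.
pose G N := [set x | s < cabs (g x)] `&` W N.
have mGN N : measurable (G N) by exact: measurableI.
have GE : \bigcup_N G N = [set x | s < cabs (g x)].
  apply/seteqP; split=> [x [N _ []]//|x sx].
  have [N _ WN] : (\bigcup_N W N) x by rewrite TW.
  by exists N.
have := @nondecreasing_cvg_mu _ _ _ (vol R n) G mGN.
rewrite GE => /(_ mG) cG.
have {}cG : vol R n (G N) @[N --> \oo] --> distribution_function g s.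
  apply: cG => i j ij; apply/subsetPset => x [sx Wx]; split=> //.
  by move/subsetPset: (ndW _ _ ij); apply.
have [N _ hN] := cG _ (open_ereal_gt' cg).
have cGN : (c%:E < vol R n (G N))%E by apply: hN => /=.
have GNfin : vol R n (G N) \is a fin_num.
  rewrite ge0_fin_numE//; apply: le_lt_trans (Wfin N); apply: le_measure; rewrite ?inE//.
  by move=> x [].
exists (G N), (fine (vol R n (G N))); split=> //.
- by have [M hM] := bW N; exists M => x [_ /hM].
- by rewrite fineK.
- by rewrite -lte_fin fineK.
rewrite EFinM fineK// -integral_cst//.
apply: ge0_le_integral.
- exact: mGN.
- by move=> x _; rewrite lee_fin ltW.
- exact: measurable_cst.
- apply/measurable_EFinP; apply: (measurable_funS measurableT (@subsetT _ _)).
  exact: measurable_cabs.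
- by move=> x [/= sx _]; rewrite lee_fin ltW.
Qed.

End exhaustion.

Lemma ae_integral_le_series d (X : measurableType d) (R : realType)
    (mu : {measure set X -> \bar R}) (F : set X) (g : X -> \bar R) (u : nat -> X -> \bar R) :
  measurable F -> measurable_fun F g -> (forall x, 0 <= g x)%E ->
  (forall m, measurable_fun F (u m)) -> (forall m x, (0 <= u m x)%E) ->
  {ae mu, forall x, (g x <= \sum_(0 <= m <oo) u m x)%E} ->
  (\int[mu]_(x in F) g x <= \sum_(0 <= m <oo) \int[mu]_(x in F) u m x)%E.
Proof.
move=> mF mg g0 mu' u0 fu; rewrite -integral_nneseries//.
apply: ae_ge0_le_integral => //.
- by move=> x _; exact: nneseries_ge0.
- exact: ge0_emeasurable_sum.
- by apply: filterS fu => x + _.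
Qed.

Section indicator_series.
Context (X : Type) (R : realType) (G : nat -> set X).
Hypothesis tG : trivIset setT G.

Lemma sum_indic_disjoint k x N : G k x ->
  \sum_(0 <= m < N) \1_(G m) x = ((k < N)%N)%:R :> R.
Proof.
move=> Gk; have E m : \1_(G m) x = (m == k)%:R :> R.
  rewrite indicE; congr (nat_of_bool _)%:R; apply/idP/eqP => [|->]; rewrite inE// => Gm.
  by apply: tG => //; exists x.
under eq_bigr do rewrite E.
elim: N => [|N IH]; first by rewrite big_nil.
rewrite big_nat_recr//= IH ltnS -natrD; congr (_%:R).
by case: ltngtP.
Qed.

Lemma sum_indic_notin x N : ~ (\bigcup_m G m) x ->
  \sum_(0 <= m < N) \1_(G m) x = 0 :> R.
Proof.
move=> Gx; rewrite big1// => m _; rewrite indicE memNset// => Gm.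
by apply: Gx; exists m.
Qed.

Lemma sum_indic_le x N : \sum_(0 <= m < N) \1_(G m) x <= \1_(\bigcup_m G m) x :> R.
Proof.
have [[k _ Gk]|Gx] := pselect ((\bigcup_m G m) x).
  rewrite (sum_indic_disjoint _ Gk) indicE mem_set; last by exists k.
  by case: (k < N)%N.
by rewrite sum_indic_notin.
Qed.

Lemma cvg_sum_indic x :
  (\sum_(0 <= m < N) \1_(G m) x : R) @[N --> \oo] --> (\1_(\bigcup_m G m) x : R).
Proof.
apply: cvg_near_cst.
have [[k kT Gk]|Gx] := pselect ((\bigcup_m G m) x).
  exists k.+1 => // N kN; rewrite (sum_indic_disjoint _ Gk) indicE mem_set; last by exists k.
  by rewrite kN.
by apply: nearW => N; rewrite sum_indic_notin// indicE memNset.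
Qed.

End indicator_series.

Section restricted.
Variables (R : realType) (n : nat).
Local Notation cabs := (@ComplexField.Normc.normc R).
Variables (D : set (Rn R n -> R[i])) (T : (Rn R n -> R[i]) -> (Rn R n -> R[i])).
Hypothesis sT : sublinear D T.
Implicit Types E F : set (Rn R n).

Lemma cabs_real (a : R) : cabs (a%:C)%C = `|a|.
Proof. by rewrite /= expr0n/= addr0 sqrtr_sqr. Qed.

Lemma sum_real_complex (I : Type) (s : seq I) (a : I -> R) :
  \sum_(i <- s) ((a i)%:C)%C = ((\sum_(i <- s) a i)%:C)%C.
Proof. by rewrite (rmorph_sum (real_complex R)). Qed.

Lemma measurable_cabsT f (A : set (Rn R n)) : D f ->
  measurable_fun A (fun x => (cabs (T f x))%:E).
Proof.
move=> Df; have h := measurable_cabs (sublinear_measurable sT Df).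
apply/measurable_EFinP; apply: (measurable_funS measurableT (@subsetT _ A) h).
Qed.

(** The series of the indicators of disjoint sets converges pointwise and is
    dominated by the indicator of the union, which lies in the domain of T. *)
Lemma integral_chi_bigcup_le (G : nat -> set (Rn R n)) E F :
  (forall m, measurable (G m)) -> trivIset setT G -> \bigcup_m G m = E ->
  (vol R n E < +oo)%E -> measurable F ->
  (\int[vol R n]_(x in F) (cabs (T (chi E) x))%:E <=
   \sum_(0 <= m <oo) \int[vol R n]_(x in F) (cabs (T (chi (G m)) x))%:E)%E.
Proof.
move=> mG tG GE Efin mF.
have mE : measurable E by rewrite -GE; exact: bigcup_measurable.
have DG m : D (chi (G m)).
  apply: (sublinear_chi sT) => //; apply: le_lt_trans Efin.
  by apply: le_measure; rewrite ?inE// -GE; exact: bigcup_sup.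
have DE : D (chi E) by exact: (sublinear_chi sT).
apply: ae_integral_le_series.
- exact: mF.
- exact: measurable_cabsT.
- by move=> x; rewrite lee_fin cabs_ge0.
- by move=> m; exact: measurable_cabsT.
- by move=> m x; rewrite lee_fin cabs_ge0.
have sE x := @cvg_sum_indic _ R G tG x.
rewrite GE in sE.
apply: (sublinear_series sT DE DE DG).
- apply: aeW => x; move: (sE x) => /cvgrPdist_lt h; apply/cvgrPdist_lt => e e0; move: (h e e0).
  apply: filterS => N /=; rewrite sub0r normrN.
  rewrite /chi sum_real_complex -(rmorphB (real_complex R)) cabs_real normr_id//.
- apply: aeW => x; rewrite /chi cabs_real ger0_norm//.
  apply: lime_le.
    by apply: is_cvg_nneseries => m _ _; rewrite lee_fin cabs_ge0.
  apply: nearW => N.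
  under eq_bigr do rewrite cabs_real ger0_norm//.
  by rewrite sumEFin lee_fin -GE sum_indic_le.
Qed.

Let rtype a b K := forall E F, measurable E -> bounded_subset E -> measurable F ->
  bounded_subset F -> (\int[vol R n]_(x in F) (cabs (T (chi E) x))%:E
      <= K%:E * vol R n E `^ a * vol R n F `^ (1 - b)%R)%E.

(** E is cut along a bounded exhaustion, so fast that the pieces after the first
    one, estimated with the exponent a', contribute at most e; the first piece
    is bounded and obeys the estimate with exponent a. The second exponent is
    what makes this work for a = 0, where small pieces have no small bound. *)
Lemma restricted_type_unbounded (a b a' b' K : R) : 0 <= K -> 0 <= a -> 0 < a' ->
  rtype a b K -> rtype a' b' K ->
  forall E F, measurable E -> (vol R n E < +oo)%E -> measurable F ->
  bounded_subset F -> (vol R n F < +oo)%E ->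
  (\int[vol R n]_(x in F) (cabs (T (chi E) x))%:E
      <= K%:E * vol R n E `^ a * vol R n F `^ (1 - b)%R)%E.
Proof.
move=> K0 a0 a'0 H H' E F mE Efin mF bF Ffin.
have [W [ndW TW mW bW Wfin]] := bounded_exhaustion R n.
apply/lee_addgt0Pr => e e0.
(* adding 1 makes L positive, so that e can be divided by it *)
pose L := K * fine (vol R n F `^ (1 - b')%R)%E + 1.
have L0 : 0 < L by rewrite ltr_pwDr// mulr_ge0// fine_ge0// poweR_ge0.
have tail : forall k : nat, exists N : nat,
    (vol R n (E `\` W N) <= (((e / (2 ^ k.+2)%:R) / L) `^ a'^-1)%:E)%E.
  move=> k; set dl := ((_ / _) `^ _).
  have dl0 : 0 < dl by rewrite powR_gt0// !divr_gt0// ltr0n expn_gt0.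
  have c0 : vol R n (E `\` W N) @[N --> \oo] --> 0%E.
    have F0 : (vol R n (E `\` W 0%N) < +oo)%E.
      apply: le_lt_trans Efin; apply: le_measure; rewrite ?inE//.
      exact: measurableD.
    have mF' N : measurable (E `\` W N) by exact: measurableD.
    have capE : \bigcap_N (E `\` W N) = set0.
      apply/seteqP; split=> // x h; have [m _ Wm] : (\bigcup_m W m) x by rewrite TW.
      by have [_] := h m I.
    have := @nonincreasing_cvg_mu _ _ _ (vol R n) (fun N => E `\` W N) F0 mF'.
    rewrite capE measure0; apply=> //.
    move=> i j ij; apply/subsetPset => x [Ex Wx]; split=> // Wi; apply: Wx.
    by move/subsetPset: (ndW _ _ ij); apply.
  have dl0' : (0 < dl%:E)%E by rewrite lte_fin.
  have [N _ hN] := c0 _ (open_ereal_lt' dl0').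
  by exists N; apply: ltW; apply: hN => /=.
have [N hN] := choice tail.
(* r is increasing, tends to infinity and dominates N *)
pose r k := (\sum_(i < k.+1) (N i).+1)%N.
have r_ge k : (N k <= r k)%N by rewrite /r big_ord_recr/= (leq_trans (leqnSn _))// leq_addl.
have r_inc k : (r k <= r k.+1)%N by rewrite [r k.+1]/r big_ord_recr/= leq_addr.
have r_id k : (k <= r k)%N.
  elim: k => // k IH; rewrite [r k.+1]/r big_ord_recr/= -/(r k).
  by rewrite addnS ltnS (leq_trans IH)// leq_addr.
have r_nd : {homo r : i j / (i <= j)%N >-> (i <= j)%N}.
  by apply: homo_leq => //; exact: leq_trans.
pose A k := E `&` W (r k).
have ndA : nondecreasing_seq A.
  move=> i j /r_nd/ndW /subsetPset ij; apply/subsetPset.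
  by apply: setIS.
have mA k : measurable (A k) by exact: measurableI.
pose G := seqD A.
have mG k : measurable (G k).
  by case: k => [|k]; [exact: mA|apply: measurableD; exact: mA].
have GE : \bigcup_k G k = E.
  rewrite eq_bigcup_seqD; apply/seteqP; split=> [x [k _ []]//|x Ex].
  have [m _ Wm] : (\bigcup_m W m) x by rewrite TW.
  exists m => //; split=> //; move: Wm.
  by move/subsetPset: (ndW _ _ (r_id m)); apply.
apply: le_trans (integral_chi_bigcup_le mG (trivIset_seqD ndA) GE Efin mF) _.
have bG k : bounded_subset (G k).
  have [M hM] := bW (r k); exists M => x Gx; apply: hM.
  by case: k Gx => [|k]; [move=> []|move=> [[]]].
set main := (K%:E * _ * _)%E.
have main0 : (0 <= main)%E by rewrite !mule_ge0 ?poweR_ge0.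
pose B k : \bar R := if k is 0%N then main else 0%E.
have B0 k : (0 <= B k)%E by case: k.
apply: (@le_trans _ _ (\sum_(0 <= k <oo) (B k + (e / (2 ^ k.+1)%:R)%:E))%E); last first.
  apply: le_trans (epsilon_trick xpredT B0 (ltW e0)) _; rewrite leeD2r//.
  rewrite nneseries_recl// eseries0 ?adde0// => -[|k]//.
apply: lee_nneseries => [k _ _|[|k] _].
- by apply: integral_ge0 => x _; rewrite lee_fin cabs_ge0.
- apply: (@le_trans _ _ main); last by rewrite leeDl// lee_fin divr_ge0 ?ltW.
  apply: le_trans (H _ _ (mG 0%N) (bG 0%N) mF bF) _.
  apply: lee_wpmul2r; first exact: poweR_ge0.
  apply: lee_wpmul2l; first by rewrite lee_fin.
  apply: gt0_ler_poweR => //; rewrite ?in_itv/= ?leey ?andbT ?measure_ge0//.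
  by apply: le_measure; rewrite ?inE// => x [].
rewrite /B add0e; apply: le_trans (H' _ _ (mG k.+1) (bG k.+1) mF bF) _.
have e'0 : 0 < e / (2 ^ k.+2)%:R by rewrite divr_gt0// ltr0n expn_gt0.
have Gsmall : (vol R n (G k.+1) `^ a' <= (e / (2 ^ k.+2)%:R / L)%:E)%E.
  have -> : e / (2 ^ k.+2)%:R / L = ((e / (2 ^ k.+2)%:R / L) `^ a'^-1) `^ a'.
    by rewrite -powRrM mulVf ?gt_eqF// powRr1// divr_ge0 ?ltW.
  rewrite -poweR_EFin; apply: gt0_ler_poweR; rewrite ?in_itv/= ?leey ?andbT ?(ltW a'0) ?measure_ge0//.
    by rewrite lee_fin powR_ge0.
  apply: le_trans (hN k); apply: (@le_measure _ _ _ (vol R n)).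
  - by apply: mem_set; exact: (mG k.+1).
  - by apply: mem_set; exact: measurableD.
  move=> x [[Ex _] nA]; split=> // Wx; apply: nA; split=> //.
  by move: Wx; move/subsetPset: (ndW _ _ (r_ge k)); apply.
have Ffin' : (vol R n F `^ (1 - b')%R)%E \is a fin_num.
  by rewrite ge0_fin_numE ?poweR_ge0// poweR_lty.
rewrite -(fineK Ffin') muleAC -EFinM.
apply: le_trans (lee_wpmul2l _ Gsmall) _.
  by rewrite lee_fin mulr_ge0// fine_ge0// poweR_ge0.
rewrite -EFinM lee_fin mulrC mulrAC ler_pdivrMr// ler_wpM2l ?(ltW e'0)//.
by rewrite /L lerDl.
Qed.

End restricted.

(** * Binary digits and the sublinearity of T *)

Section digits.
Variable R : realType.

Let h (c : R) (j : int) : R := 2 ^ j * (Num.floor (c / 2 ^ j))%:~R.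
Definition digit (c : R) (j : int) : R := (odd `|Num.floor (c / 2 ^ j)|%N)%:R.

Lemma floor_half (y : R) : 0 <= y ->
  Num.floor y = (Num.floor (y / 2) * 2 + (odd `|Num.floor y|%N)%:R :> int).
Proof.
move=> y0.
have : 0 <= Num.floor y by rewrite floor_ge0.
case E : (Num.floor y) => [m|//] _ /=.
have /andP[m1 m2] := floor_itv y; rewrite E in m1 m2.
have mE : m%:R = (odd m)%:R + 2 * (m./2)%:R :> R.
  by rewrite -{1}(odd_double_half m) natrD -mul2n natrM.
have -> : Num.floor (y / 2) = Posz m./2.
  apply: floor_def; move: m1 m2; rewrite !intrD -!pmulrn mE.
  have : 0 <= ((odd m)%:R : R) <= 1 by case: (odd m); rewrite ?ler01 ?lexx.
  move: ((odd m)%:R : R) ((m./2)%:R : R) => o hm o01 m1 m2; apply/andP; split; lra.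
rewrite -{1}(odd_double_half m) PoszD addrC; congr (_ + _); first by rewrite -muln2 PoszM.
by case: (odd m).
Qed.

(** With h_j = 2^j floor(c / 2^j), the digit times its weight 2^j is
    h_j - h_(j+1), so the binary series telescopes. *)
Lemma digitE (c : R) (j : int) : 0 <= c -> 2 ^ j * digit c j = h c j - h c (j + 1).
Proof.
move=> c0; rewrite /h /digit.
have p0 : 0 < 2 ^ j :> R by rewrite exprz_gt0.
rewrite exprzDr ?expr1z ?unitfE ?pnatr_eq0//.
have -> : c / (2 ^ j * 2) = c / 2 ^ j / 2 by rewrite invfM mulrA.
have y0 : 0 <= c / 2 ^ j by rewrite divr_ge0// ltW.
rewrite [in RHS](floor_half y0) intrD mulrDr intrM.
have -> : (odd `|Num.floor (c / 2 ^ j)|%N)%:R%:~R = (odd `|Num.floor (c / 2 ^ j)|%N)%:R :> R.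
  by case: (odd _).
ring.
Qed.

Lemma digit_partial_sum (c : R) N : 0 <= c ->
  \sum_(0 <= m < N) (2 ^ Posz m * digit c (Posz m) + 2 ^ Negz m * digit c (Negz m)) =
  h c (- N%:Z) - h c N%:Z.
Proof.
move=> c0; elim: N => [|N IH]; first by rewrite big_nil oppr0 subrr.
rewrite big_nat_recr//= IH !digitE// NegzE.
have -> : - N.+1%:Z + 1 = - N%:Z :> int by rewrite -addn1 PoszD opprD subrK.
have -> : N%:Z + 1 = N.+1%:Z :> int by rewrite -addn1 PoszD.
ring.
Qed.

Lemma digit_partial_sum_le (c : R) N : 0 <= c ->
  \sum_(0 <= m < N) (2 ^ Posz m * digit c (Posz m) + 2 ^ Negz m * digit c (Negz m)) <= c.
Proof.
move=> c0; rewrite digit_partial_sum//.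
have h0 : 0 <= h c N%:Z.
  by rewrite mulr_ge0 ?exprz_ge0// ler0z floor_ge0 divr_ge0// exprz_ge0.
have : h c (- N%:Z) <= c.
  by rewrite /h mulrC -ler_pdivlMr ?exprz_gt0// ge_floor.
lra.
Qed.

Lemma cvg_digit_partial_sum (c : R) : 0 <= c ->
  \sum_(0 <= m < N) (2 ^ Posz m * digit c (Posz m) + 2 ^ Negz m * digit c (Negz m))
    @[N --> \oo] --> c.
Proof.
move=> c0.
have cl : c - (2^-1 : R) ^+ N @[N --> \oo] --> c.
  rewrite -[X in _ --> X]subr0; apply: cvgB; first exact: cvg_cst.
  by apply: cvg_expr; rewrite ger0_norm// invf_lt1// ltr1n.
apply: squeeze_cvgr cl (cvg_cst c).
near=> N; rewrite digit_partial_sum_le// andbT digit_partial_sum//.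
have -> : h c N%:Z = 0.
  rewrite /h (_ : Num.floor _ = 0) ?mulr0//; apply: floor_def.
  rewrite divr_ge0 ?exprz_ge0//= add0r ltr_pdivrMr ?exprz_gt0// mul1r.
  apply: (@lt_le_trans _ _ N%:R).
    apply: (lt_le_trans (archi_boundP c0)); rewrite ler_nat.
    by near: N; exact: nbhs_infty_ge.
  by rewrite -exprnP -natrX ler_nat ltnW// ltn_expl.
rewrite subr0 /h -invr_expz -exprnP exprVn; set p := (2 ^+ N)^-1.
have p0 : 0 < p by rewrite invr_gt0 exprn_gt0.
have := floorD1_gt (c / p); rewrite intrD ltr_pdivrMr// => /ltW.
by rewrite mulrDl mul1r [_ * p]mulrC lerBlDr.
Unshelve. all: by end_near.
Qed.

End digits.

Section binary.
Variables (R : realType) (n : nat).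
Local Notation cabs := (@ComplexField.Normc.normc R).
Implicit Types (f : Rn R n -> R[i]).

Definition phase (k : 'I_4) : R[i] :=
  match val k with 0 => 1 | 1 => -1 | 2 => 'i%C | _ => - 'i%C end.

Lemma cabs_phase k : cabs (phase k) = 1.
Proof.
by case: k => -[|[|[|[|//]]]] /= _; rewrite ?oppr0 ?sqrrN ?expr0n ?expr1n /= ?addr0 ?add0r sqrtr1.
Qed.

Lemma component_ge0 k f x : 0 <= component k f x.
Proof.
by case: k => -[|[|[|[|//]]]] i; rewrite /component/= /funrpos /funrneg le_max lexx orbT.
Qed.

Lemma Re_le_cabs (z : R[i]) : `|complex.Re z| <= cabs z.
Proof.
by case: z => a b /=; rewrite -sqrtr_sqr ler_sqrt ?lerDl ?sqr_ge0// addr_ge0 ?sqr_ge0.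
Qed.

Lemma Im_le_cabs (z : R[i]) : `|complex.Im z| <= cabs z.
Proof.
by case: z => a b /=; rewrite -sqrtr_sqr ler_sqrt ?lerDr ?sqr_ge0// addr_ge0 ?sqr_ge0.
Qed.

Lemma component_le_cabs k f x : component k f x <= cabs (f x).
Proof.
case: k => -[|[|[|[|//]]]] i; rewrite /component/= /funrpos /funrneg ge_max cabs_ge0 andbT.
- exact: le_trans (ler_norm _) (Re_le_cabs _).
- by apply: le_trans (Re_le_cabs _); rewrite -normrN ler_norm.
- exact: le_trans (ler_norm _) (Im_le_cabs _).
- by apply: le_trans (Im_le_cabs _); rewrite -normrN ler_norm.
Qed.

Let max_sub (c : R) : Num.max c 0 - Num.max (- c) 0 = c.
Proof.
have [c0|c0] := leP c 0; first by rewrite max_l ?oppr_ge0// sub0r opprK.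
by rewrite max_r ?subr0// oppr_le0 ltW.
Qed.

Let max_add (c : R) : Num.max c 0 + Num.max (- c) 0 = `|c|.
Proof.
have [c0|c0] := leP c 0; first by rewrite max_l ?oppr_ge0// add0r ler0_norm.
by rewrite max_r ?addr0 ?gtr0_norm// oppr_le0 ltW.
Qed.

Lemma sum_phase_component f x :
  \sum_(k < 4) phase k * ((component k f x)%:C)%C = f x.
Proof.
rewrite !big_ord_recl big_ord0 /phase /component/= /funrpos /funrneg.
case: (f x) => a b /=; have := max_sub a; have := max_sub b.
move: (Num.max a 0) (Num.max (- a) 0) (Num.max b 0) (Num.max (- b) 0) => a1 a2 b1 b2 hb ha.
by apply/eqP; rewrite eq_complex/=; apply/andP; split; apply/eqP; lra.
Qed.

Lemma sum_component_le f x : \sum_(k < 4) component k f x <= 2 * cabs (f x).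
Proof.
rewrite !big_ord_recl big_ord0 /component/= /funrpos /funrneg.
have := Re_le_cabs (f x); have := Im_le_cabs (f x); rewrite -!max_add; lra.
Qed.

Lemma chi_binary_set f j k x :
  chi (binary_set f j k) x = ((digit (component k f x) j)%:C)%C.
Proof.
rewrite /chi /digit indicE; congr ((_ %:R)%:C)%C.
by congr nat_of_bool; apply/idP/idP; rewrite inE.
Qed.

(** The m-th block of the binary series consists of the digits of weights 2^m
    and 2^(-m-1), so that its partial sums are differences h_(-N) - h_N. *)
Definition signed_index (m : nat) (s : bool) : int := if s then Posz m else Negz m.

Definition binary_term f (m : nat) (z : bool * 'I_4) : Rn R n -> R[i] := fun x =>
  phase z.2 * ((2 ^ signed_index m z.1 : R)%:C)%C * chi (binary_set f (signed_index m z.1) z.2) x.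

Lemma sum_binary_term f N x :
  \sum_(0 <= m < N) \sum_z binary_term f m z x =
  \sum_(k < 4) phase k * ((\sum_(0 <= m < N) (2 ^ Posz m * digit (component k f x) (Posz m) +
     2 ^ Negz m * digit (component k f x) (Negz m)))%:C)%C.
Proof.
under [RHS]eq_bigr do rewrite -sum_real_complex big_distrr/=.
rewrite [RHS]exchange_big/=; apply: eq_bigr => m _.
rewrite -(pair_bigA _ (fun s k => binary_term f m (s, k) x))/=.
rewrite big_bool/= -big_split/=; apply: eq_bigr => k _.
rewrite /binary_term/= !chi_binary_set rmorphD !rmorphM/= mulrDr !mulrA.
by [].
Qed.

Lemma cabs_sum (I : Type) (s : seq I) (a : I -> R[i]) :
  cabs (\sum_(i <- s) a i) <= \sum_(i <- s) cabs (a i).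
Proof.
elim: s => [|i s IH]; first by rewrite !big_nil ComplexField.Normc.normc0.
rewrite !big_cons (le_trans (le_normcD _ _))// lerD2l//.
Qed.

Lemma cvg_binary_term f x :
  cabs (f x - \sum_(0 <= m < N) \sum_z binary_term f m z x) @[N --> \oo] --> (0 : R).
Proof.
pose S N k : R := \sum_(0 <= m < N) (2 ^ Posz m * digit (component k f x) (Posz m) +
     2 ^ Negz m * digit (component k f x) (Negz m)).
have cS : \sum_(k < 4) `|component k f x - S N k| @[N --> \oo] --> (0 : R).
  have term k : `|component k f x - S N k| @[N --> \oo] --> (0 : R).
    rewrite (_ : 0 = `|component k f x - component k f x|); last by rewrite subrr normr0.
    apply: cvg_norm; apply: cvgB; first exact: cvg_cst.
    exact: cvg_digit_partial_sum (component_ge0 _ _ _).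
  elim: (index_enum _) => [|k s IH].
    by under eq_fun do rewrite big_nil; exact: cvg_cst.
  under eq_fun do rewrite big_cons.
  have h := cvgD (term k) IH; rewrite addr0 in h.
  exact: h.
apply: squeeze_cvgr (cvg_cst 0) cS; apply: nearW => N; rewrite cabs_ge0/=.
rewrite sum_binary_term -{1}(sum_phase_component f x) -sumrB.
apply: le_trans (cabs_sum _ _) _; apply: ler_sum => k _.
by rewrite -mulrBr -(rmorphB (real_complex R)) ComplexField.Normc.normcM cabs_phase mul1r cabs_real.
Qed.

Lemma binary_term_dominated f N x :
  \sum_(0 <= m < N) cabs (\sum_z binary_term f m z x) <= 2 * cabs (f x).
Proof.
apply: le_trans (sum_component_le f x).
apply: (@le_trans _ _ (\sum_(0 <= m < N) \sum_(k < 4) (2 ^ Posz m * digit (component k f x) (Posz m) +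
     2 ^ Negz m * digit (component k f x) (Negz m)))).
  apply: ler_sum => m _.
  rewrite -(pair_bigA _ (fun s k => binary_term f m (s, k) x))/= big_bool/= -big_split/=.
  apply: le_trans (cabs_sum _ _) _; apply: ler_sum => k _.
  rewrite /binary_term/= !chi_binary_set (le_trans (le_normcD _ _))//.
  rewrite !ComplexField.Normc.normcM cabs_phase !cabs_real !mul1r.
  by rewrite !ger0_norm ?exprz_ge0.
rewrite exchange_big/=; apply: ler_sum => k _.
exact: digit_partial_sum_le (component_ge0 _ _ _).
Qed.

Section operator.
Variables (D : set (Rn R n -> R[i])) (T : (Rn R n -> R[i]) -> (Rn R n -> R[i])).
Hypothesis sT : sublinear D T.

Lemma sublinear_sum (I : Type) (s : seq I) (c : I -> R[i]) (a : I -> Rn R n -> R[i]) f : D f ->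
  (forall i, D (a i)) ->
  D (fun x => \sum_(i <- s) c i * a i x) /\
  {ae vol R n, forall x, cabs (T (fun x => \sum_(i <- s) c i * a i x) x) <=
     \sum_(i <- s) cabs (c i) * cabs (T (a i) x)}.
Proof.
move=> Df Da; elim: s => [|i s [Ds IH]].
  have -> : (fun x => \sum_(i <- [::]) c i * a i x) = (fun x => 0 * f x).
    by apply/funext => x; rewrite big_nil mul0r.
  split; first exact: (sublinear_scale_closed sT).
  have := sublinear_scale sT 0 Df; apply: filterS => x ->.
  by rewrite ComplexField.Normc.normc0 mul0r big_nil.
have E : (fun x => \sum_(j <- i :: s) c j * a j x) =
    (fun x => c i * a i x) \+ (fun x => \sum_(j <- s) c j * a j x).
  by apply/funext => x; rewrite big_cons.
have Dc : D (fun x => c i * a i x) by exact: (sublinear_scale_closed sT).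
rewrite E; split; first exact: (sublinear_addr_closed sT).
have h1 := sublinear_add sT Dc Ds; have h2 := sublinear_scale sT (c i) (Da i).
apply: filterS3 IH h1 h2 => x IH h1 h2.
by rewrite big_cons (le_trans h1)// -h2 lerD2l.
Qed.

(** The blocks of the binary series are dominated by |Re f| + |Im f|, hence by
    2 |f|, and 2 f is in the domain of T. *)
Lemma sublinear_binary f : D f -> (forall j k, D (chi (binary_set f j k))) ->
  {ae vol R n, forall x, ((cabs (T f x))%:E <= \sum_(0 <= m <oo) \sum_z
     (2 ^ signed_index m z.1 * cabs (T (chi (binary_set f (signed_index m z.1) z.2)) x))%:E)%E}.
Proof.
move=> Df Dchi.
pose c m (z : bool * 'I_4) : R[i] := phase z.2 * ((2 ^ signed_index m z.1 : R)%:C)%C.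
have cc m z : cabs (c m z) = 2 ^ signed_index m z.1.
  by rewrite /c ComplexField.Normc.normcM cabs_phase mul1r cabs_real ger0_norm// exprz_ge0.
pose g m x := \sum_z binary_term f m z x.
have hg m := sublinear_sum (index_enum _) (c m) Df (fun z => Dchi (signed_index m z.1) z.2).
have Dg m : D (g m) by have [] := hg m.
have D2f : D (fun x => 2 * f x) by exact: (sublinear_scale_closed sT).
have h1 : {ae vol R n, forall x, ((cabs (T f x))%:E <= \sum_(0 <= m <oo) (cabs (T (g m) x))%:E)%E}.
  apply: (sublinear_series sT Df D2f Dg).
    by apply: aeW => x; exact: cvg_binary_term.
  apply: aeW => x; apply: lime_le.
    by apply: is_cvg_nneseries => m _ _; rewrite lee_fin cabs_ge0.
  apply: nearW => N; rewrite sumEFin lee_fin ComplexField.Normc.normcM.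
  have -> : cabs 2 = 2 by rewrite -[2 in LHS](rmorph_nat (real_complex R)) cabs_real ger0_norm.
  exact: binary_term_dominated.
have h2 : {ae vol R n, forall x, forall m, cabs (T (g m) x) <= \sum_z cabs (c m z) *
    cabs (T (chi (binary_set f (signed_index m z.1) z.2)) x)}.
  by apply: ae_foralln => m; have [] := hg m.
apply: filterS2 h1 h2 => x h1 h2.
apply: le_trans h1 _; apply: lee_nneseries => [m _ _|m _].
  by rewrite lee_fin cabs_ge0.
rewrite sumEFin lee_fin (le_trans (h2 m))//; apply: ler_sum => z _.
by rewrite cc.
Qed.

End operator.
End binary.

(** * Level sets of T f *)

Section binary_pieces.
Variables (R : realType) (n : nat).
Local Notation cabs := (@ComplexField.Normc.normc R).
Variables (D : set (Rn R n -> R[i])) (T : (Rn R n -> R[i]) -> (Rn R n -> R[i])).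
Hypothesis sT : sublinear D T.
Variable f : Rn R n -> R[i].
Hypotheses (Df : D f) (Dchi : forall j k, D (chi (binary_set f j k))).

Let I (F : set (Rn R n)) j k := (\int[vol R n]_(x in F) (cabs (T (chi (binary_set f j k)) x))%:E)%E.

Let I_ge0 F j k : (0 <= I F j k)%E.
Proof. by apply: integral_ge0 => x _; rewrite lee_fin cabs_ge0. Qed.

Lemma integral_binary_le F : measurable F ->
  (\int[vol R n]_(x in F) (cabs (T f x))%:E <=
   \esum_(j in [set: int]) \sum_(k < 4) ((2 ^ j)%:E * I F j k))%E.
Proof.
move=> mF.
have mchi j k : measurable_fun F (fun x => (cabs (T (chi (binary_set f j k)) x))%:E).
  exact (@measurable_cabsT _ _ _ _ sT _ F (Dchi j k)).
pose t m (z : bool * 'I_4) x : \bar R := ((2 ^ signed_index m z.1)%:E *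
  (cabs (T (chi (binary_set f (signed_index m z.1) z.2)) x))%:E)%E.
have mt m z : measurable_fun F (t m z).
  by apply: emeasurable_funM; [exact: measurable_cst|exact: mchi].
have t0 m z x : (0 <= t m z x)%E by rewrite mule_ge0// lee_fin ?exprz_ge0 ?cabs_ge0.
apply: (@le_trans _ _ (\sum_(0 <= m <oo) \int[vol R n]_(x in F) (\sum_z t m z x))%E).
  apply: ae_integral_le_series.
  - exact: mF.
  - exact (@measurable_cabsT _ _ _ _ sT _ F Df).
  - by move=> x; rewrite lee_fin cabs_ge0.
  - by move=> m; exact: emeasurable_sum.
  - by move=> m x; apply: sume_ge0 => z _.
  - exact (@sublinear_binary _ _ _ _ sT _ Df Dchi).
rewrite esum_int; last first.
  by move=> j; apply: sume_ge0 => k _; rewrite mule_ge0// lee_fin exprz_ge0.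
apply: lee_nneseries => [m _ _|m _].
  by apply: integral_ge0 => x _; apply: sume_ge0 => z _.
rewrite ge0_integral_sum//.
rewrite (eq_bigr (fun z : bool * 'I_4 => (2 ^ signed_index m z.1)%:E *
    I F (signed_index m z.1) z.2)%E); last first.
  move=> z _; rewrite /t ge0_integralZl_EFin//.
  - by move=> x _; rewrite lee_fin cabs_ge0.
  - by rewrite exprz_ge0.
rewrite -(pair_bigA _ (fun s k => (2 ^ signed_index m s)%:E * I F (signed_index m s) k)%E)/=.
by rewrite big_bool.
Qed.

(** Subadditivity on a bounded part F of the level set, divided by its measure t.
    The constant 8 is 4 components times a factor 2 lost in t > 2^(M-1). *)
Lemma distribution_le_piece_bound (a0 a1 b0 b1 th K A : R) (x : int -> R) :
  0 <= b0 <= 1 -> 0 <= b1 <= 1 -> 0 < th < 1 -> 0 < K -> 0 <= A ->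
  let b := (1 - th) * b0 + th * b1 in
  (forall j k F t, measurable F -> bounded_subset F -> vol R n F = t%:E -> 0 < t ->
    [/\ ((2 ^ j)%:E * I F j k <= (K * (2 `^ j%:~R * x j `^ a0 * t `^ (1 - b0)))%:E)%E,
        ((2 ^ j)%:E * I F j k <= (K * (2 `^ j%:~R * x j `^ a1 * t `^ (1 - b1)))%:E)%E &
        ((2 ^ j)%:E * I F j k <= (K * (A * t `^ (1 - b)))%:E)%E]) ->
  forall i M : int, ((2 `^ M%:~R)%:E <= distribution_function (T f) (2 `^ i%:~R))%E ->
   ((2 `^ i%:~R)%:E <= (8 * K)%:E *
      \esum_(j in [set: int]) (piece_bound a0 a1 b0 b1 th x A M j)%:E)%E.
Proof.
move=> b001 b101 th01 K0 A0 b hI i M Mi.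
have [|||F [t [mF bF Ft Mt iF]]] := @superlevel_bounded_part _ _ (T f) (2 `^ i%:~R) (2 `^ (M%:~R - 1)).
- exact: (sublinear_measurable sT).
- exact: exp2_gt0.
- by apply: lt_le_trans Mi; rewrite lte_fin ltr_exp2; lra.
have t0 : 0 < t by rewrite (lt_trans _ Mt)// exp2_gt0.
have m0 j : 0 <= piece_bound a0 a1 b0 b1 th x A M j by exact: piece_bound_ge0.
rewrite -(@lee_pmul2l _ t%:E) ?fin_numE ?lte_fin// -EFinM mulrC.
apply: le_trans iF _; apply: le_trans (integral_binary_le mF) _.
rewrite muleA -EFinM -esumZl; [|by rewrite !mulr_ge0 ?ltW|by move=> j; rewrite lee_fin].
apply: le_esum => j _.
have pw bi : 0 <= bi <= 1 -> t `^ (1 - bi) <= t * (2 * 2 `^ (- (M%:~R * bi))).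
  move=> /andP[bi0 bi1]; rewrite powRD; last by rewrite (gt_eqF t0) implybT.
  rewrite powRr1 ?(ltW t0)// ler_pM2l// powRN; apply: (@le_trans _ _ (2 `^ ((M%:~R - 1) * bi))^-1).
    rewrite lef_pV2 ?posrE ?powR_gt0// powRrM.
    by rewrite ge0_ler_powR ?nnegrE ?powR_ge0 ?(ltW t0) ?(ltW Mt).
  rewrite -powRN -[X in _ <= X * _](powRr1 (ler0n R 2)) -exp2D ler_exp2; lra.
have bb : 0 <= b <= 1.
  move: b001 b101 th01 => /andP[b00 b01] /andP[b10 b11] /andP[th0 th1].
  have th1' : 0 <= 1 - th by lra.
  have := mulr_ge0 th1' b00; have := mulr_ge0 (ltW th0) b10.
  have := ler_wpM2l th1' b01; have := ler_wpM2l (ltW th0) b11.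
  rewrite /b; lra.
have tK : 0 <= K by exact: ltW.
have bound k : ((2 ^ j)%:E * I F j k <= (2 * K * t * piece_bound a0 a1 b0 b1 th x A M j)%:E)%E.
  have [h0 h1 h2] := hI j k F t mF bF Ft t0.
  have c0 : 0 <= 2 * K * t by rewrite !mulr_ge0 ?ltW.
  rewrite /piece_bound !minr_pMr// !EFin_min !le_min; apply/andP; split; first (apply/andP; split).
  - apply: le_trans h0 _; rewrite lee_fin.
    apply: le_trans (ler_wpM2l tK (ler_wpM2l _ (pw _ b001))) _; rewrite ?mulr_ge0 ?powR_ge0//.
    rewrite le_eqVlt; apply/orP; left; apply/eqP; ring.
  - apply: le_trans h1 _; rewrite lee_fin.
    apply: le_trans (ler_wpM2l tK (ler_wpM2l _ (pw _ b101))) _; rewrite ?mulr_ge0 ?powR_ge0//.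
    rewrite le_eqVlt; apply/orP; left; apply/eqP; ring.
  - apply: le_trans h2 _; rewrite lee_fin.
    apply: le_trans (ler_wpM2l tK (ler_wpM2l A0 (pw _ bb))) _.
    rewrite le_eqVlt; apply/orP; left; apply/eqP; ring.
apply: (@le_trans _ _ (\sum_(k < 4) (2 * K * t * piece_bound a0 a1 b0 b1 th x A M j)%:E)%E).
  by apply: lee_sum => k _.
rewrite !big_ord_recl big_ord0 -!EFinD lee_fin; lra.
Qed.

End binary_pieces.

(** * The theorem *)

Section exponents.
Variable R : realType.
Implicit Types p q : \bar R.

Lemma rinv_EFin (r : R) : 1 <= r -> rinv r%:E = r^-1.
Proof. by move=> r1; rewrite /rinv inver gt_eqF ?(lt_le_trans ltr01). Qed.

Lemma rinv_pinfty : rinv (+oo : \bar R) = 0.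
Proof. by rewrite /rinv invey. Qed.

Lemma rinv_itv p : (1 <= p)%E -> 0 <= rinv p <= 1.
Proof.
case: p => [r|_|//]; last by rewrite rinv_pinfty lexx ler01.
rewrite lee_fin => r1; rewrite rinv_EFin// invr_ge0 invf_le1 ?(lt_le_trans ltr01)// r1 andbT.
by rewrite (le_trans ler01).
Qed.

Lemma rinv_neq p q : (1 <= p)%E -> (1 <= q)%E -> p <> q -> rinv p != rinv q.
Proof.
case: p q => [r| |] [s| |]//; rewrite ?lee_fin.
- move=> r1 s1 rs; rewrite !rinv_EFin//; apply/negP => /eqP/invr_inj rs'.
  by apply: rs; rewrite rs'.
- by move=> r1 _ _; rewrite rinv_pinfty rinv_EFin// invr_eq0 gt_eqF// (lt_le_trans ltr01).
- by move=> _ s1 _; rewrite rinv_pinfty rinv_EFin// eq_sym invr_eq0 gt_eqF// (lt_le_trans ltr01).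
Qed.

End exponents.

Lemma lorentz_ge0 (R : realType) n (p : R) (v : \bar R) (f : Rn R n -> R[i]) :
  (1 <= v)%E -> (0 <= lorentz p v f)%E.
Proof.
case: v => [r| |//] _; first exact: poweR_ge0.
apply: (@le_trans _ _ (1%:E * distribution_function f 1 `^ p^-1)%E).
  by rewrite mule_ge0 ?poweR_ge0 ?lee_fin.
by apply: ereal_sup_ubound; exists 1 => //=; rewrite in_itv/= ltr01.
Qed.

Lemma lorentz_interpolation (R : realType) (a0 a1 b0 b1 th u nu K q : R) (v : \bar R) :
  0 < th < 1 -> 0 <= a0 <= 1 -> 0 <= a1 <= 1 -> 0 <= b0 -> 0 <= b1 ->
  a0 != a1 -> b0 != b1 -> 0 < u -> 0 < nu < 1 -> 0 < K ->
  q^-1 = (1 - th) * b0 + th * b1 -> (u%:E < v)%E -> (u%:E <= nu%:E * v)%E ->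
  exists2 C : R, 0 < C &
  forall n (g : Rn R n -> R[i]) (x : int -> R) (A B : R), cmeasurable g ->
    (forall j, 0 <= x j) -> 0 <= A -> 0 <= B ->
    (\esum_(j in [set: int]) (2 `^ (j%:~R * u) * x j `^ (((1 - th) * a0 + th * a1) * u))%:E
      <= (B `^ u)%:E)%E ->
    (forall i M : int, (2 `^ M%:~R)%:E <= distribution_function g (2 `^ i%:~R) ->
     (2 `^ i%:~R)%:E <= K%:E * \esum_(j in [set: int]) (piece_bound a0 a1 b0 b1 th x A M j)%:E)%E ->
    (lorentz q v g <= (C * A `^ (1 - nu) * B `^ nu)%:E)%E.
Proof.
move=> th01 a001 a101 b00 b10 a01 b01 u0 nu01 K0 qE uv unv.
have q0 : 0 < q by rewrite -invr_gt0 qE convex_comb_gt0.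
case: v uv unv => [v|_ _|//].
  rewrite lte_fin -EFinM lee_fin => uv unv; have v0 : 0 < v by exact: lt_trans uv.
  have [C C0 hC] := interpolation_sum th01 a001 a101 b00 b10 a01 b01 u0 nu01 v0 unv K0.
  exists ((q * 2 `^ v) `^ v^-1 * C); first by rewrite mulr_gt0// powR_gt0// mulr_gt0// exp2_gt0.
  move=> n g x A B mg x0 A0 B0 xB H.
  have := hC x A B (fun i => distribution_function g (2 `^ i%:~R)) x0 A0 B0
    (fun i => distribution_function_ge0 _ _) xB H.
  rewrite -qE => h; rewrite -!mulrA [C * _]mulrA.
  apply: lorentz_le_dyadic_sum => //.
  by rewrite !mulr_ge0 ?powR_ge0 ?ltW.
have [C C0 hC] := interpolation_sup th01 a001 a101 b00 b10 a01 b01 u0 nu01 K0.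
exists (2 * C); first by rewrite mulr_gt0.
move=> n g x A B mg x0 A0 B0 xB H.
have := hC x A B (fun i => distribution_function g (2 `^ i%:~R)) x0 A0 B0
    (fun i => distribution_function_ge0 _ _) xB H.
rewrite -qE => h; rewrite -!mulrA [C * _]mulrA.
apply: lorentz_sup_le => //.
by rewrite !mulr_ge0 ?powR_ge0 ?ltW.
Qed.

Section sets.
Variables (R : realType) (n : nat) (f : Rn R n -> R[i]).
Local Notation cabs := (@ComplexField.Normc.normc R).

Lemma measurable_of_chi (E : set (Rn R n)) : cmeasurable (chi E) -> measurable E.
Proof.
move=> [mRe _]; rewrite (_ : E = [set x | 0 < complex.Re (chi E x)]).
  exact: measurable_superlevel.
apply/seteqP; split=> x /=; rewrite indicE.
  by move=> Ex; rewrite mem_set.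
by case: (boolP (x \in E)) => [/set_mem//|_]; rewrite ltxx.
Qed.

(** A nonzero digit of weight 2^j of a component forces this component to be at
    least 2^j; a smaller level makes the inequality strict. *)
Lemma binary_set_superlevel j k :
  binary_set f j k `<=` [set x | 2 `^ (j%:~R - 1) < cabs (f x)].
Proof.
move=> x; rewrite /binary_set/= => fx.
apply: lt_le_trans (component_le_cabs k f x).
have p0 : 0 < 2 ^ j :> R by rewrite exprz_gt0.
apply: (@lt_le_trans _ _ (2 ^ j)).
  by rewrite -powR_intmul// ltr_exp2; lra.
rewrite -(mul1r (2 ^ j)) -ler_pdivlMr// -floor_gt0 lt_def.
rewrite floor_ge0 divr_ge0 ?component_ge0 ?(ltW p0)// andbT.
by apply/eqP => f0; move: fx; rewrite f0.
Qed.

Lemma vol_binary_set_le j k : cmeasurable f -> measurable (binary_set f j k) ->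
  (vol R n (binary_set f j k) <= distribution_function f (2 `^ (j%:~R - 1)))%E.
Proof.
move=> mf mF; apply: (@le_measure _ _ _ (vol R n)).
- exact: mem_set.
- by apply: mem_set; apply: measurable_superlevel; exact: measurable_cabs.
- exact: binary_set_superlevel.
Qed.

End sets.

Section two_bounds.
Variable R : realType.
Local Notation cabs := (@ComplexField.Normc.normc R).

Lemma cmeasurable_scale n (c : R) (g : Rn R n -> R[i]) : cmeasurable g ->
  cmeasurable (fun x => (c%:C)%C * g x).
Proof.
move=> [mRe mIm]; split.
  rewrite (_ : (fun x => _) = (fun x => c * complex.Re (g x))); last first.
    by apply/funext => x; case: (g x) => y z /=; rewrite mul0r subr0.
  by apply: measurable_funM.
rewrite (_ : (fun x => _) = (fun x => c * complex.Im (g x))); last first.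
  by apply/funext => x; case: (g x) => y z /=; rewrite mul0r addr0.
by apply: measurable_funM.
Qed.

(** The embedding of L^(q,v) in weak L^q, followed by Hölder's inequality. *)
Lemma integral_chi_le_lorentz (q : R) (v : \bar R) : 0 < q^-1 < 1 -> (1 <= v)%E ->
  exists2 C : R, 0 < C & forall n (g : Rn R n -> R[i]) (j : int) (A : R) F t,
    cmeasurable g -> 0 <= A ->
    (lorentz q v (fun x => ((2 ^ j)%:C)%C * g x)%R <= A%:E)%E ->
    measurable F -> vol R n F = t%:E -> 0 < t ->
    ((2 ^ j)%:E * \int[vol R n]_(x in F) (cabs (g x))%:E <= (C * (A * t `^ (1 - q^-1)))%:E)%E.
Proof.
move=> q01 v1; have q0 : 0 < q by rewrite -invr_gt0; case/andP: q01.
have [C1 C10 hC1] := weak_le_lorentz q0 v1.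
have [C2 C20 hC2] := integral_le_weak_norm q01.
exists (C2 * C1); first by rewrite mulr_gt0.
move=> n g j A F t mg A0 gA mF Ft t0.
have mjg := cmeasurable_scale (2 ^ j) mg.
have mjg' := measurable_cabs mjg.
have w := hC1 n _ A mjg A0 gA.
have CA0 : 0 <= C1 * A by rewrite mulr_ge0// ltW.
have := hC2 _ _ (vol R n) _ F _ t mjg' (fun x => cabs_ge0 _) mF CA0 t0 Ft w.
under eq_integral do rewrite ComplexField.Normc.normcM cabs_real ger0_norm ?exprz_ge0// EFinM.
rewrite ge0_integralZl_EFin.
- by rewrite -!mulrA.
- exact: mF.
- by move=> x _; rewrite lee_fin cabs_ge0.
- by apply/measurable_EFinP; apply: (measurable_funS measurableT (@subsetT _ F)); exact: measurable_cabs.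
- by rewrite exprz_ge0.
Qed.

Lemma restricted_type_le n (T : (Rn R n -> R[i]) -> (Rn R n -> R[i])) p q (K K' : R) :
  K <= K' -> restricted_type T p q K -> restricted_type T p q K'.
Proof.
move=> KK H E F mE bE mF bF; apply: le_trans (H E F mE bE mF bF) _.
by rewrite lee_wpmul2r ?poweR_ge0// lee_wpmul2r ?poweR_ge0// lee_fin.
Qed.

(** As p0 and p1 differ, one of them is finite, and serves as the second exponent
    in restricted_type_unbounded. *)
Lemma restricted_type_finite n D (T : (Rn R n -> R[i]) -> (Rn R n -> R[i]))
    (p0 p1 q0 q1 : \bar R) (K : R) :
  sublinear D T -> 0 <= K -> (1 <= p0)%E -> (1 <= p1)%E -> p0 <> p1 ->
  restricted_type T p0 q0 K -> restricted_type T p1 q1 K ->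
  forall E F, measurable E -> (vol R n E < +oo)%E -> measurable F ->
  bounded_subset F -> (vol R n F < +oo)%E ->
  (\int[vol R n]_(x in F) (cabs (T (chi E) x))%:E
      <= K%:E * vol R n E `^ rinv p0 * vol R n F `^ (1 - rinv q0)%R)%E.
Proof.
move=> sT K0 p01 p11 pp H0 H1 E F mE Efin mF bF Ffin.
have /andP[a0 _] := rinv_itv p01; have /andP[a1 _] := rinv_itv p11.
have := rinv_neq p01 p11 pp.
have [a00|a0n] := eqVneq (rinv p0) 0 => pn.
  have a10 : 0 < rinv p1 by rewrite lt_def a1 eq_sym -a00 pn.
  exact: (restricted_type_unbounded sT K0 a0 a10 H0 H1).
have a00 : 0 < rinv p0 by rewrite lt_def a0n.
exact: (restricted_type_unbounded sT K0 a0 a00 H0 H0).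
Qed.

End two_bounds.

(** d = (1 - u/v) / u <= 1 - u/v, hence u <= (1 - d) v; halving d keeps the
    exponent positive when d = 1. *)
Lemma interpolation_exponent (R : realType) (u v : \bar R) (d := rinv u - rinv v) :
  (1 <= u)%E -> (u < v)%E ->
  [/\ 0 < d, d <= 1 & (u <= (1 - d / 2)%:E * v)%E].
Proof.
rewrite {}/d; case: u => [u|//|//]; last first.
  by move=> _; rewrite ltNge leey.
rewrite lee_fin => u1; have u0 : 0 < u by rewrite (lt_le_trans ltr01).
have ui : 0 < u^-1 by rewrite invr_gt0.
have ui1 : u^-1 <= 1 by rewrite invf_le1.
case: v => [v|_|//]; last first.
  rewrite rinv_EFin// rinv_pinfty subr0; split=> //.
  by rewrite gt0_muley ?leey// lte_fin; lra.
rewrite lte_fin => uv; have v0 : 0 < v by exact: lt_trans uv.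
have v1 : 1 <= v by rewrite (le_trans u1)// ltW.
have vi : 0 < v^-1 by rewrite invr_gt0.
rewrite !rinv_EFin//; split.
- by rewrite subr_gt0 ltf_pV2.
- lra.
rewrite -EFinM lee_fin.
have -> : (1 - (u^-1 - v^-1) / 2) * v = v - (v - u) / 2 * u^-1.
  by field; rewrite !gt_eqF.
have : (v - u) / 2 * u^-1 <= (v - u) / 2 by rewrite ler_piMr// divr_ge0// subr_ge0 ltW.
lra.
Qed.

Section profile.
Variable R : realType.

Lemma distribution_function_fin n (p : R) (u : \bar R) (f : Rn R n -> R[i]) (L : R) :
  0 < p -> (1 <= u)%E -> cmeasurable f -> 0 <= L -> (lorentz p u f <= L%:E)%E ->
  forall i : int, (distribution_function f (2 `^ i%:~R) < +oo)%E.
Proof.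
move=> p0 u1 mf L0 fL i; have [C C0 hC] := weak_le_lorentz p0 u1.
have CL0 : 0 <= C * L by rewrite mulr_ge0// ltW.
have pV : 0 < p^-1 by rewrite invr_gt0.
have := le_of_weak_bound pV CL0 (distribution_function_ge0 _ _) (hC n f L mf L0 fL i).
by move=> /le_lt_trans; apply; rewrite ltry.
Qed.

Lemma distribution_function_eq0 n (p : R) (u : \bar R) (f : Rn R n -> R[i]) :
  0 < p -> (1 <= u)%E -> cmeasurable f -> (lorentz p u f <= 0)%E ->
  forall i : int, distribution_function f (2 `^ i%:~R) = 0%E.
Proof.
move=> p0 u1 mf fL i; have [C C0 hC] := weak_le_lorentz p0 u1.
have pV : 0 < p^-1 by rewrite invr_gt0.
have CL0 : 0 <= C * 0 by rewrite mulr0.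
have := le_of_weak_bound pV CL0 (distribution_function_ge0 _ _) (hC n f 0 mf (lexx 0) fL i).
rewrite mulr0 mul0r powR0 ?invr_eq0 ?gt_eqF// => h.
by apply/eqP; rewrite eq_le h distribution_function_ge0.
Qed.

(** The levels are 2^(j-1), those that contain the pieces of height 2^j; the
    shift costs the first factor 2^u. *)
Lemma dyadic_profile n (p u : R) (f : Rn R n -> R[i]) (L : R) :
  0 < p -> 1 <= u -> cmeasurable f -> 0 <= L -> (lorentz p u%:E f <= L%:E)%E ->
  (\esum_(j in [set: int]) (2 `^ (j%:~R * u) *
      (fine (distribution_function f (2 `^ (j%:~R - 1)))) `^ (p^-1 * u))%:E
   <= (((2 `^ u * (2 `^ u * 2 / p)) `^ u^-1 * L) `^ u)%:E)%E.
Proof.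
move=> p0 u1 mf L0 fL; have u0 : 0 < u by rewrite (lt_le_trans ltr01).
have u1' : (1 <= u%:E)%E by rewrite lee_fin.
have dfin := distribution_function_fin p0 u1' mf L0 fL.
have := dyadic_sum_le_lorentz p0 u0 mf L0 fL.
set S := (\esum_(i in [set: int]) _)%E => hS.
have k0 : 0 <= 2 `^ u * 2 / p by rewrite divr_ge0 ?mulr_ge0 ?powR_ge0 ?(ltW p0).
have -> : ((2 `^ u * (2 `^ u * 2 / p)) `^ u^-1 * L) `^ u = 2 `^ u * (2 `^ u * 2 / p * L `^ u).
  have k1 : 0 <= 2 `^ u * (2 `^ u * 2 / p) by rewrite mulr_ge0// powR_ge0.
  by rewrite powRM ?powR_ge0// -powRrM mulVf ?gt_eqF// powRr1// !mulrA.
rewrite EFinM; apply: le_trans (lee_wpmul2l _ hS); last by rewrite lee_fin powR_ge0.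
rewrite (esum_int_shift 1) /S -esumZl ?powR_ge0//; last first.
  by move=> i; rewrite mule_ge0 ?poweR_ge0 ?lee_fin ?powR_ge0.
apply: le_esum => i _; rewrite intrD addrK.
rewrite EFinM -[X in (_ * X <= _)%E]poweR_EFin fineK;
  last by rewrite ge0_fin_numE ?dfin// distribution_function_ge0.
by rewrite muleA -EFinM mulrDl mul1r exp2D mulrC.
Qed.

End profile.

Unset Implicit Arguments.
Set Strict Implicit.

Theorem lemma3p4 (R : realType) :
  exists nu : R -> R,
    (forall d : R, 0 < d -> d <= 1 -> 0 < nu d /\ nu d < 1) /\
    forall (p0 p1 q0 q1 u v : \bar R) (C0 C1 theta ptheta qtheta : R),
      (1 <= p0)%E -> (1 <= p1)%E -> (1 <= q0)%E -> (1 <= q1)%E ->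
      p0 <> p1 -> q0 <> q1 ->
      0 < theta -> theta < 1 ->
      ptheta^-1 = (1 - theta) * rinv p0 + theta * rinv p1 ->
      qtheta^-1 = (1 - theta) * rinv q0 + theta * rinv q1 ->
      (1 <= u)%E -> (u < v)%E ->
      exists C : R, 0 < C /\
        forall (n : nat) (D : set (Rn R n -> R[i]))
               (T : (Rn R n -> R[i]) -> (Rn R n -> R[i])),
          sublinear D T ->
          restricted_type T p0 q0 C0 ->
          restricted_type T p1 q1 C1 ->
          forall f : Rn R n -> R[i],
            D f ->
            (forall (j : int) (k : 'I_4), D (chi (binary_set f j k))) ->
            (lorentz qtheta v (T f) <=
              C%:E *
              ereal_sup [set lorentz qtheta v
                               (fun x => (2 ^ jk.1)%:C%C * T (chi (binary_set f jk.1 jk.2)) x)%R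
                        | jk in [set: int * 'I_4]] `^ (1 - nu (rinv u - rinv v))%R *
              lorentz ptheta u f `^ nu (rinv u - rinv v)%R)%E.
Proof.
exists (fun d => 1 - d / 2); split; first by move=> d d0 d1; split; lra.
move=> p0 p1 q0 q1 u v C0 C1 th pt qt p01 p11 q01 q11 pn qn th0 th1 ptE qtE u1 uv.
have th01 : 0 < th < 1 by rewrite th0.
have [d0 d1 unv] := interpolation_exponent u1 uv.
have nu01 : 0 < 1 - (rinv u - rinv v) / 2 < 1 by apply/andP; split; lra.
move: {d0 d1} (1 - _) unv nu01 => nu unv nu01.
case: u u1 uv unv => [u| |//]; last by move=> _; rewrite ltNge leey.
move=> u1 uv unv.
have [nu0 nu1] : 0 < nu /\ nu < 1 by case/andP: nu01.
have ur1 : 1 <= u by rewrite -lee_fin.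
have u0 : 0 < u by rewrite (lt_le_trans ltr01).
have v1 : (1 <= v)%E by rewrite (le_trans u1)// ltW.
have a0_01 := rinv_itv p01; have a1_01 := rinv_itv p11.
have b0_01 := rinv_itv q01; have b1_01 := rinv_itv q11.
have a01 := rinv_neq p01 p11 pn; have b01 := rinv_neq q01 q11 qn.
move: (a0_01) (a1_01) (b0_01) (b1_01) => /andP[a00 a0l] /andP[a10 a1l] /andP[b00 b0l] /andP[b10 b1l].
have pt0 : 0 < pt by rewrite -invr_gt0 ptE convex_comb_gt0.
have qV01 : 0 < qt^-1 < 1 by rewrite qtE convex_comb_gt0//= convex_comb_lt1.
have [CA CA0 hCA] := integral_chi_le_lorentz qV01 v1.
pose K := `|C0| + `|C1| + CA.
have K0 : 0 < K by rewrite ltr_wpDl// addr_ge0.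
have CAK : CA <= K by rewrite lerDr addr_ge0.
have C0K : C0 <= K by rewrite (le_trans (ler_norm _))// /K -addrA lerDl addr_ge0// ltW.
have C1K : C1 <= K.
  by rewrite (le_trans (ler_norm _))// /K addrAC lerDr addr_ge0// ltW.
have K80 : 0 < 8 * K by rewrite mulr_gt0.
have [C C_gt0 hC] := lorentz_interpolation th01 a0_01 a1_01 b00 b10 a01 b01 u0 nu01 K80 qtE uv unv.
(* the constant of dyadic_profile *)
pose B1 := (2 `^ u * (2 `^ u * 2 / pt)) `^ u^-1.
have B10 : 0 < B1 by rewrite powR_gt0// mulr_gt0 ?exp2_gt0// divr_gt0// mulr_gt0// exp2_gt0.
exists (C * B1 `^ nu); split; first by apply: mulr_gt0 => //; exact: powR_gt0.
move=> n D T sT H0 H1 f Df Dchi.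
have {}H0 := restricted_type_le C0K H0; have {}H1 := restricted_type_le C1K H1.
have mf : cmeasurable f by exact: (sublinear_domain sT).
have mTf : cmeasurable (T f) by exact: (sublinear_measurable sT).
have mchi j k : measurable (binary_set f j k).
  by apply: measurable_of_chi; exact: (sublinear_domain sT).
have mTchi j k : cmeasurable (T (chi (binary_set f j k))) by exact: (sublinear_measurable sT).
pose g (jk : int * 'I_4) : Rn R n -> R[i] :=
  fun x => ((2 ^ jk.1)%:C)%C * T (chi (binary_set f jk.1 jk.2)) x.
rewrite -/g; set A := ereal_sup _; set L := lorentz pt u%:E f.
have gA j k : (lorentz qt v (g (j, k)) <= A)%E.
  by apply: ereal_sup_ubound; exists (j, k).
have A_ge0 : (0 <= A)%E.
  by apply: le_trans (gA 0 ord0); exact: lorentz_ge0.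
have L_ge0 : (0 <= L)%E by exact: lorentz_ge0.
have boundA r : 0 <= r -> (A <= r%:E)%E -> forall j k F t,
    measurable F -> vol R n F = t%:E -> 0 < t ->
    ((2 ^ j)%:E * \int[vol R n]_(x in F)
       (ComplexField.Normc.normc (T (chi (binary_set f j k)) x))%:E
       <= (K * (r * t `^ (1 - qt^-1)))%:E)%E.
  move=> r0 Ar j k F t mF Ft t0.
  apply: le_trans (hCA n _ j r F t (mTchi j k) r0 (le_trans (gA j k) Ar) mF Ft t0) _.
  by rewrite lee_fin ler_wpM2r// mulr_ge0 ?powR_ge0.
have volx j k : (vol R n (binary_set f j k) <= distribution_function f (2 `^ (j%:~R - 1)))%E.
  exact: vol_binary_set_le.
have boundR p q (pT : (forall E F, measurable E -> (vol R n E < +oo)%E -> measurable F ->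
      bounded_subset F -> (vol R n F < +oo)%E ->
      (\int[vol R n]_(x in F) (ComplexField.Normc.normc (T (chi E) x))%:E
        <= K%:E * vol R n E `^ rinv p * vol R n F `^ (1 - rinv q)%R)%E)) j k F t m :
    measurable F -> bounded_subset F -> vol R n F = t%:E -> 0 <= rinv p ->
    (vol R n (binary_set f j k) <= m%:E)%E ->
    ((2 ^ j)%:E * \int[vol R n]_(x in F)
       (ComplexField.Normc.normc (T (chi (binary_set f j k)) x))%:E
       <= (K * (2 `^ j%:~R * m `^ rinv p * t `^ (1 - rinv q)))%:E)%E.
  move=> mF bF Ft p_ge0 vm.
  have m0 : 0 <= m by rewrite -lee_fin (le_trans _ vm).
  have vfin : (vol R n (binary_set f j k) < +oo)%E by rewrite (le_lt_trans vm)// ltry.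
  have Ffin : (vol R n F < +oo)%E by rewrite Ft ltry.
  have h := pT _ F (mchi j k) vfin mF bF Ffin; rewrite Ft in h.
  have j0 : (0 <= (2 ^ j)%:E :> \bar R)%E by rewrite lee_fin exprz_ge0.
  apply: le_trans (lee_wpmul2l j0 h) _.
  rewrite poweR_EFin -powR_intmul// muleA muleA.
  have -> : (K * (2 `^ j%:~R * m `^ rinv p * t `^ (1 - rinv q)))%:E =
      ((2 `^ j%:~R)%:E * K%:E * m%:E `^ rinv p * (t `^ (1 - rinv q))%:E)%E.
    by rewrite poweR_EFin -!EFinM; congr EFin; ring.
  apply: lee_wpmul2r; first by rewrite lee_fin powR_ge0.
  apply: lee_wpmul2l; first by rewrite -EFinM lee_fin mulr_ge0 ?powR_ge0 ?ltW.
  by apply: gt0_ler_poweR; rewrite ?in_itv/= ?leey ?andbT ?measure_ge0 ?lee_fin.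
have fin0 := @restricted_type_finite R n D T p0 p1 q0 q1 K sT (ltW K0) p01 p11 pn H0 H1.
have fin1 := @restricted_type_finite R n D T p1 p0 q1 q0 K sT (ltW K0) p11 p01 (not_eq_sym pn) H1 H0.
(* the discrete inequality with x = 0 and A = 0: if T vanishes on all pieces,
   then T f vanishes *)
have zero : (forall j k F t, measurable F -> bounded_subset F -> vol R n F = t%:E -> 0 < t ->
    ((2 ^ j)%:E * \int[vol R n]_(x in F)
       (ComplexField.Normc.normc (T (chi (binary_set f j k)) x))%:E <= 0)%E) ->
    (lorentz qt v (T f) <= 0)%E.
  move=> z; have := hC n (T f) (fun=> 0) 0 0 mTf (fun=> lexx 0) (lexx 0) (lexx 0).
  rewrite (_ : C * 0 `^ (1 - nu) * 0 `^ nu = 0); last by rewrite (powR0 (negbT (gt_eqF nu0))) mulr0.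
  apply.
    rewrite esum1 ?lee_fin ?powR_ge0// => j _.
    by rewrite powR0 ?mulr0// gt_eqF// mulr_gt0// convex_comb_gt0.
  apply: (distribution_le_piece_bound sT Df Dchi b0_01 b1_01 th01 K0 (lexx 0)) => j k F t mF bF Ft t0.
  have K0' := ltW K0.
  by split; apply: le_trans (z j k F t mF bF Ft t0) _;
    rewrite lee_fin mulr_ge0// ?mul0r// mulr_ge0 ?powR_ge0// mulr_ge0 ?powR_ge0.
have RHS_ge0 : (0 <= (C * B1 `^ nu)%:E * A `^ (1 - nu) * L `^ nu)%E.
  by rewrite !mule_ge0 ?poweR_ge0// lee_fin mulr_ge0 ?powR_ge0// ltW.
have [A0|A0] := eqVneq A 0%E.
  apply: le_trans RHS_ge0; apply: zero => j k F t mF bF Ft t0.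
  have Ale : (A <= 0%:E)%E by rewrite A0.
  by have := boundA 0 (lexx 0) Ale j k F t mF Ft t0; rewrite mul0r mulr0.
have [L0|L0] := eqVneq L 0%E.
  apply: le_trans RHS_ge0; apply: zero => j k F t mF bF Ft t0.
  have L0' : (lorentz pt u%:E f <= 0)%E by rewrite -/L L0.
  have df0 := distribution_function_eq0 pt0 u1 mf L0'.
  have v0 : (vol R n (binary_set f j k) <= 0%:E)%E.
    by have := volx j k; rewrite -(intrB _ _ 1) df0.
  have [a0e|a0n] := eqVneq (rinv p0) 0.
    have a1n : rinv p1 != 0 by rewrite -a0e eq_sym.
    have := boundR p1 q1 fin1 j k F t 0 mF bF Ft a10 v0.
    by rewrite powR0// mulr0 mul0r mulr0.
  have := boundR p0 q0 fin0 j k F t 0 mF bF Ft a00 v0.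
  by rewrite powR0// mulr0 mul0r mulr0.
have nu1n : 1 - nu != 0 by rewrite gt_eqF// subr_gt0.
have Ap : (0 < A `^ (1 - nu))%E by apply: poweR_gt0; rewrite lt_def A0.
have Lp : (0 < L `^ nu)%E by apply: poweR_gt0; rewrite lt_def L0.
have CBp : (0 < (C * B1 `^ nu)%:E)%E by rewrite lte_fin mulr_gt0// powR_gt0.
case EA : A A_ge0 A0 Ap => [r| |//] A_ge0 A0 Ap; last first.
  by rewrite poweRyr// gt0_muley// gt0_mulye// leey.
case EL : L L_ge0 L0 Lp => [l| |//] L_ge0 L0 Lp; last first.
  by rewrite poweRyr ?gt_eqF// gt0_muley// ?leey// mule_gt0.
rewrite lee_fin in A_ge0; rewrite lee_fin in L_ge0.
have Ar : (A <= r%:E)%E by rewrite EA.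
have Ll : (lorentz pt u%:E f <= l%:E)%E by rewrite -/L EL.
pose x (j : int) : R := fine (distribution_function f (2 `^ (j%:~R - 1))).
have x0 j : 0 <= x j by rewrite fine_ge0// distribution_function_ge0.
have xE j : (x j)%:E = distribution_function f (2 `^ (j%:~R - 1)).
  rewrite /x fineK// ge0_fin_numE ?distribution_function_ge0// -(intrB _ _ 1).
  exact: (distribution_function_fin pt0 u1 mf L_ge0 Ll).
have Bl0 : 0 <= B1 * l by rewrite mulr_ge0// ltW.
have xB : (\esum_(j in [set: int]) (2 `^ (j%:~R * u) *
      x j `^ (((1 - th) * rinv p0 + th * rinv p1) * u))%:E <= ((B1 * l) `^ u)%:E)%E.
  by rewrite -ptE; exact: dyadic_profile.
clearbody x B1.
have h := hC n (T f) x r (B1 * l) mTf x0 A_ge0 Bl0 xB.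
move: h.
rewrite !poweR_EFin -!EFinM (powRM _ (ltW B10) L_ge0).
rewrite (_ : C * r `^ (1 - nu) * (B1 `^ nu * l `^ nu) = C * B1 `^ nu * r `^ (1 - nu) * l `^ nu); last by ring.
apply; apply: (distribution_le_piece_bound sT Df Dchi b0_01 b1_01 th01 K0 A_ge0) => j k F t mF bF Ft t0.
split.
- by apply: boundR => //; rewrite xE.
- by apply: (boundR p1 q1 fin1) => //; rewrite xE.
- by rewrite -qtE; exact: boundA.
Qed.
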